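(* Let $d,n\ge1$ and let $A_0,A_1,\dots,A_n\in\mathbb{C}^{d\times d}_{\mathrm{herm}}$. Consider the following two semidefinite programs. (P) minimize $c$ over $c\in\mathbb{R}$ and $Z,Y_1,\dots,Y_n\in\mathbb{C}^{d\times d}_{\mathrm{herm}}$ subject to $$Z\succeq0,\qquad \begin{bmatrix}Y_i&A_i\\ A_i&Y_i+Z\end{bmatrix}\succeq0\ \text{ for all }i\in[n],\qquad Z+A_0+\sum_{i=1}^nY_i\preceq cI_d;$$ (D) maximize $\langle A_0,\Delta\rangle+\sum_{i=1}^n\langle A_i,R_i+R_i^*\rangle$ over $\Delta,S_i,T_i\in\mathbb{C}^{d\times d}_{\mathrm{herm}}$ and $R_i\in\mathbb{C}^{d\times d}$ ($i\in[n]$) subject to $$\begin{bmatrix}S_i&-R_i\\ -R_i^*&T_i\end{bmatrix}\succeq0\ \text{ and }\ S_i+T_i=\Delta\ \text{ for all }i\in[n],\qquad \Delta-\sum_{i=1}^nT_i\succeq0,\qquad \mathrm{Tr}(\Delta)=1.$$ Then the values of (P) and (D) are both equal to $\Lambda_{\mathrm{rad}}(A_0,A_1,\dots,A_n)$. The two programs are Lagrangian duals of one another, and the minimum in (P) and the maximum in (D) are both always achieved.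
   Context: $\mathbb{C}^{d\times d}_{\mathrm{herm}}$ is the set of $d\times d$ complex Hermitian matrices; $\succeq,\succ,\preceq$ denote the Loewner order; $\langle X,Y\rangle=\mathrm{Tr}(X^*Y)$; $[n]=\{1,\dots,n\}$. For a bounded self-adjoint operator, $\lambda_{\max}$ is the maximum of its spectrum. A free Rademacher family $(r_i)_{i=1}^n$ may be realized as follows: let $G=(\mathbb{Z}/2\mathbb{Z})^{*n}$ be the free product with generators $g_1,\dots,g_n$ ($g_i^2=1$), and let $r_i$ be left multiplication by $g_i$ on $\ell^2(G)$. Define $$\Lambda_{\mathrm{rad}}(A_0,\dots,A_n)=\lambda_{\max}\Big(A_0\otimes1+\sum_{i=1}^nA_i\otimes r_i\Big).$$ Known theorem of Lehner (1999), which may be taken as an equivalent definition: $$\Lambda_{\mathrm{rad}}(A_0,\dots,A_n)=\inf_{Z\in\mathbb{C}^{d\times d}_{\mathrm{herm}},\,Z\succ0}\lambda_{\max}\Big(Z+A_0+\sum_{i=1}^n\tfrac12Z^{1/2}\big((I_d+4(Z^{-1/2}A_iZ^{-1/2})^2)^{1/2}-I_d\big)Z^{1/2}\Big).$$ *)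

(* Defs.v *)
From mathcomp Require Import all_boot all_order all_algebra.
From mathcomp Require Import all_classical all_reals ereal.
From mathcomp Require Import spectral complex.

Set Implicit Arguments.
Unset Strict Implicit.
Unset Printing Implicit Defensive.

Import Order.TTheory GRing.Theory Num.Theory.

Local Open Scope classical_set_scope.
Local Open Scope sesquilinear_scope.
Local Open Scope complex_scope.
Local Open Scope ring_scope.

Section Matrices.
Context {R : realType}.
Implicit Types m : nat.

(* The order on R[i] makes 0 <= z mean that z is real and nonnegative. *)
Definition psdmx m (X : 'M[R[i]]_m) : Prop :=
  X \is hermsymmx /\ forall v : 'cV[R[i]]_m, 0 <= (v ^t* *m X *m v) 0 0.

Definition pdmx m (X : 'M[R[i]]_m) : Prop :=
  X \is hermsymmx /\
  forall v : 'cV[R[i]]_m, v != 0 -> 0 < (v ^t* *m X *m v) 0 0.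

(* The real part of Tr (X^* Y); the trace itself is real whenever X and Y are
   Hermitian, which is the case everywhere below. *)
Definition mxdot m (X Y : 'M[R[i]]_m) : R := complex.Re (\tr (X ^t* *m Y)).

(* For a Hermitian X of positive size the set is finite, nonempty and consists
   of the whole spectrum, so that sup is a maximum. *)
Definition lambda_max m (X : 'M[R[i]]_m) : R :=
  sup [set x : R | eigenvalue X x%:C].

(* The positive semidefinite square root of a positive semidefinite X. *)
Definition sqrtmx m (X : 'M[R[i]]_m) : 'M[R[i]]_m :=
  xget 0 [set B | psdmx B /\ B *m B = X].

End Matrices.

Section Lambda.
Context {R : realType} {d n : nat}.
Implicit Types Z : 'M[R[i]]_d.

(* (1/2) Z^(1/2) ((I + 4 (Z^(-1/2) A Z^(-1/2))^2)^(1/2) - I) Z^(1/2) *)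
Definition lehner_term Z (Ai : 'M[R[i]]_d) : 'M[R[i]]_d :=
  let Q := sqrtmx Z in
  let B := invmx Q *m Ai *m invmx Q in
  2^-1 *: (Q *m (sqrtmx (1%:M + 4 *: (B *m B)) - 1%:M) *m Q).

(* lambda_max (A0 (x) 1 + \sum_i A_i (x) r_i) for a free Rademacher family
   (r_i), given by Lehner's formula.  The infimum is taken in \bar R, so that
   no convention about infima of unbounded sets of reals is involved. *)
Definition Lambda_rad (A0 : 'M[R[i]]_d) (A : 'I_n -> 'M[R[i]]_d) : \bar R :=
  ereal_inf [set (lambda_max (Z + A0 + \sum_(i < n) lehner_term Z (A i)))%:E
            | Z in [set Z | pdmx Z]].

End Lambda.

Record primal_var (R : realType) (d n : nat) := PrimalVar {
  pc : R;
  pZ : 'M[R[i]]_d;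
  pY : 'I_n -> 'M[R[i]]_d }.

Record dual_var (R : realType) (d n : nat) := DualVar {
  dDelta : 'M[R[i]]_d;
  dS : 'I_n -> 'M[R[i]]_d;
  dT : 'I_n -> 'M[R[i]]_d;
  dR : 'I_n -> 'M[R[i]]_d }.

Section Programs.
Context {R : realType} {d n : nat}.
Variables (A0 : 'M[R[i]]_d) (A : 'I_n -> 'M[R[i]]_d).
Implicit Types (x : primal_var R d n) (y : dual_var R d n).

Definition primal_hermitian x : Prop :=
  pZ x \is hermsymmx /\ forall i, pY x i \is hermsymmx.

Definition primal_block x (i : 'I_n) : 'M[R[i]]_(d + d) :=
  block_mx (pY x i) (A i) (A i) (pY x i + pZ x).

Definition primal_slack x : 'M[R[i]]_d :=
  (pc x)%:C%:M - (pZ x + A0 + \sum_(i < n) pY x i).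

Definition primal_feasible x : Prop :=
  [/\ primal_hermitian x,
      psdmx (pZ x),
      forall i, psdmx (primal_block x i) &
      psdmx (primal_slack x)].

Definition primal_value : \bar R :=
  ereal_inf [set (pc x)%:E | x in [set x | primal_feasible x]].

Definition dual_hermitian y : Prop :=
  dDelta y \is hermsymmx /\
  forall i, dS y i \is hermsymmx /\ dT y i \is hermsymmx.

Definition dual_block y (i : 'I_n) : 'M[R[i]]_(d + d) :=
  block_mx (dS y i) (- dR y i) (- (dR y i) ^t*) (dT y i).

Definition dual_slack y : 'M[R[i]]_d := dDelta y - \sum_(i < n) dT y i.

Definition dual_feasible y : Prop :=
  [/\ dual_hermitian y,
      forall i, psdmx (dual_block y i) /\ dS y i + dT y i = dDelta y,
      psdmx (dual_slack y) &
      \tr (dDelta y) = 1].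

Definition dual_objective y : R :=
  mxdot A0 (dDelta y) + \sum_(i < n) mxdot (A i) (dR y i + (dR y i) ^t*).

Definition dual_value : \bar R :=
  ereal_sup [set (dual_objective y)%:E | y in [set y | dual_feasible y]].

(* Lagrangian duality.  In each program the sign conditions on the matrix
   variables are kept as the domain, and the remaining constraints are
   dualized: a semidefinite constraint has a positive semidefinite multiplier,
   an equality between Hermitian matrices a Hermitian one, a real equality a
   real one.  The multipliers of one program then range over the domain of the
   other. *)

Definition primal_domain x : Prop := primal_hermitian x /\ psdmx (pZ x).

(* The condition on dDelta y is implied by the constraints of the program,
   since dDelta y = dS y i + dT y i (for 0 < n). *)
Definition dual_domain y : Prop :=
  [/\ dual_hermitian y,
      psdmx (dDelta y) &
      forall i, psdmx (dual_block y i)].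

(* Multipliers: dual_block y i for primal_block x i, and dDelta y for
   primal_slack x.  Every positive semidefinite matrix of size d + d is of the
   form dual_block y i. *)
Definition primal_lagrangian x y : R :=
  pc x - \sum_(i < n) mxdot (dual_block y i) (primal_block x i)
       - mxdot (dDelta y) (primal_slack x).

(* Multipliers: pY x i for dS y i + dT y i = dDelta y, pZ x for dual_slack y,
   and pc x for \tr (dDelta y) = 1. *)
Definition dual_lagrangian y x : R :=
  dual_objective y
  + \sum_(i < n) mxdot (pY x i) (dDelta y - (dS y i + dT y i))
  + mxdot (pZ x) (dual_slack y)
  + pc x * (1 - complex.Re (\tr (dDelta y))).

(* Maximizing the Lagrangian dual function of the minimization program over
   its multipliers is the maximization program. *)
Definition dual_is_lagrangian_dual_of_primal : Prop :=
  (forall y, dual_feasible y -> dual_domain y) /\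
  forall y, dual_domain y ->
    let g := ereal_inf [set (primal_lagrangian x y)%:E
                       | x in [set x | primal_domain x]] in
    (dual_feasible y -> g = (dual_objective y)%:E) /\
    (~ dual_feasible y -> g = -oo%E).

Definition primal_is_lagrangian_dual_of_dual : Prop :=
  (forall x, primal_feasible x -> primal_domain x) /\
  forall x, primal_domain x ->
    let h := ereal_sup [set (dual_lagrangian y x)%:E
                       | y in [set y | dual_domain y]] in
    (primal_feasible x -> h = (pc x)%:E) /\
    (~ primal_feasible x -> h = +oo%E).

End Programs.

(* Main.v *)
Require Import Defs.
From mathcomp Require Import all_boot all_order all_algebra.
From mathcomp Require Import all_classical all_reals ereal.
From mathcomp Require Import spectral complex.
From mathcomp Require Import topology normedtype derive function_spaces.
From mathcomp Require Import ring lra.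

Set Implicit Arguments.
Unset Strict Implicit.
Unset Printing Implicit Defensive.

Import Order.TTheory GRing.Theory Num.Theory.

Local Open Scope classical_set_scope.
Local Open Scope sesquilinear_scope.
Local Open Scope complex_scope.
Local Open Scope ring_scope.

(** Fix a positive definite Z and put B = Z^(-1/2) A Z^(-1/2). The Lehner term
    of A is Y = Z^(1/2) V Z^(1/2), where V = ((1 + 4 B^2)^(1/2) - 1) / 2 is the
    positive semidefinite root of V^2 + V = B^2 ([lehner_termE]). This equation
    is equivalent to Y = A (Y + Z)^-1 A ([lehner_term_fixpoint]), while by Schur
    complements the block constraint of the minimization program says that Y
    lies above A (Y + Z)^-1 A. So the Lehner terms are the choice of the Y_i for
    which the Schur complements vanish, and they give feasible points
    ([lehner_primal_feasible]): the minimum is at most Lambda_rad.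

    Conversely, for a fixed Z the Lehner term need not be the least admissible
    Y, so Z has to move. Given a feasible point with Z positive definite, consider
    the feasible points with the same c and a Z at least as large, and among
    them one that maximizes the trace of Z. Lowering every Y_i to
    A_i (Y_i + Z)^-1 A_i and adding the total gain to Z preserves feasibility;
    by maximality the gain is 0, so the Y_i are the Lehner terms of Z and
    Lambda_rad is at most c ([lehner_le_feasible]). A singular Z is first
    perturbed by a small multiple of the identity.

    The two Lagrangians are one and the same bilinear expression
    ([lagrangian_sym]), affine in each argument. On feasible arguments it reduces
    to the objective plus pairings of positive semidefinite matrices, whose sign
    is known; a violated constraint provides a direction of the domain along
    which it is unbounded. Weak duality is a by-product.

    Attainment follows from compactness: in both programs traces are bounded,
    and a positive semidefinite matrix is bounded by its trace
    ([psd_family_min]).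

    There is no duality gap. For t above the dual value, the vectors formed by
    the residuals of the dual constraints and by t minus the objective, for all
    trace-normalized positive semidefinite blocks, form a compact convex set
    that avoids 0. Its point of least norm gives separating multipliers
    ([multipliers]), which become a feasible point with c = t after shifting Z
    and each Y_i by multiples of the identity ([strong_duality]). *)

(** * Adjoints and the real trace pairing *)

Section Adjoint.
Context {R : realType}.
Local Notation C := R[i].

Lemma conj_realC (c : R) : Num.conj (c%:C : C) = c%:C.
Proof. exact: conjc_real. Qed.

Lemma ReD (x y : C) : complex.Re (x + y) = complex.Re x + complex.Re y.
Proof. by case: x y => [a b] []. Qed.

Lemma ReN (x : C) : complex.Re (- x) = - complex.Re x.
Proof. by case: x. Qed.

Lemma ReZ (c : R) (x : C) : complex.Re (c%:C * x) = c * complex.Re x.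
Proof. by case: x => a b /=; rewrite mul0r subr0. Qed.

Lemma Re_conjc (x : C) : complex.Re (Num.conj x) = complex.Re x.
Proof. by case: x. Qed.

Lemma Re_sum (I : Type) (r : seq I) (P : pred I) (F : I -> C) :
  complex.Re (\sum_(i <- r | P i) F i) = \sum_(i <- r | P i) complex.Re (F i).
Proof. by apply: (big_morph (@complex.Re R)) => //; exact: ReD. Qed.

Lemma Re_tr_sum m (I : Type) (r : seq I) (P : pred I) (F : I -> 'M[C]_m) :
  complex.Re (\tr (\sum_(i <- r | P i) F i)) =
  \sum_(i <- r | P i) complex.Re (\tr (F i)).
Proof.
apply: (big_morph (fun X : 'M[C]_m => complex.Re (\tr X))) => [X Y|].
  by rewrite mxtraceD ReD.
by rewrite mxtrace0.
Qed.

Lemma trmxC_D m n (X Y : 'M[C]_(m, n)) : (X + Y) ^t* = X ^t* + Y ^t*.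
Proof. by rewrite linearD map_mxD. Qed.

Lemma trmxC_N m n (X : 'M[C]_(m, n)) : (- X) ^t* = - X ^t*.
Proof. by rewrite linearN map_mxN. Qed.

Lemma trmxC_B m n (X Y : 'M[C]_(m, n)) : (X - Y) ^t* = X ^t* - Y ^t*.
Proof. by rewrite trmxC_D trmxC_N. Qed.

Lemma trmxC_0 m n : (0 : 'M[C]_(m, n)) ^t* = 0.
Proof. by rewrite linear0 map_mx0. Qed.

Lemma trmxC_M m n p (X : 'M[C]_(m, n)) (Y : 'M[C]_(n, p)) :
  (X *m Y) ^t* = Y ^t* *m X ^t*.
Proof. by rewrite trmx_mul map_mxM. Qed.

Lemma trmxC_Z m n (c : R) (X : 'M[C]_(m, n)) : (c%:C *: X) ^t* = c%:C *: X ^t*.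
Proof. by rewrite linearZ /= map_mxZ /= conj_realC. Qed.

Lemma trmxC_scalar m (c : R) : (c%:C%:M : 'M[C]_m) ^t* = c%:C%:M.
Proof. by rewrite tr_scalar_mx map_scalar_mx /= conj_realC. Qed.

Lemma trmxC_1 m : (1%:M : 'M[C]_m) ^t* = 1%:M.
Proof. exact: (trmxC_scalar m 1). Qed.

Lemma trmxC_sum m n (I : Type) (r : seq I) (P : pred I) (F : I -> 'M[C]_(m, n)) :
  (\sum_(i <- r | P i) F i) ^t* = \sum_(i <- r | P i) (F i) ^t*.
Proof.
by apply: (big_morph (fun X : 'M[C]_(m, n) => X ^t*));
  [exact: trmxC_D | exact: trmxC_0].
Qed.

Lemma trmxC_block m1 m2 n1 n2 (X : 'M[C]_(m1, n1)) (Y : 'M[C]_(m1, n2))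
    (Z : 'M[C]_(m2, n1)) (W : 'M[C]_(m2, n2)) :
  (block_mx X Y Z W) ^t* = block_mx (X ^t*) (Z ^t*) (Y ^t*) (W ^t*).
Proof. by rewrite tr_block_mx map_block_mx. Qed.

Lemma hermP m (X : 'M[C]_m) : (X \is hermsymmx) <-> X ^t* = X.
Proof.
by rewrite qualifE /= expr0 scale1r; split=> [/eqP/esym|/esym/eqP].
Qed.

Lemma herm_trmxC m (X : 'M[C]_m) : X \is hermsymmx -> X ^t* = X.
Proof. by move/hermP. Qed.

Lemma herm0 m : (0 : 'M[C]_m) \is hermsymmx.
Proof. by apply/hermP; exact: trmxC_0. Qed.

Lemma hermD m (X Y : 'M[C]_m) :
  X \is hermsymmx -> Y \is hermsymmx -> X + Y \is hermsymmx.
Proof. by move=> /hermP hX /hermP hY; apply/hermP; rewrite trmxC_D hX hY. Qed.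

Lemma hermB m (X Y : 'M[C]_m) :
  X \is hermsymmx -> Y \is hermsymmx -> X - Y \is hermsymmx.
Proof. by move=> /hermP hX /hermP hY; apply/hermP; rewrite trmxC_B hX hY. Qed.

Lemma hermZ m (c : R) (X : 'M[C]_m) :
  X \is hermsymmx -> c%:C *: X \is hermsymmx.
Proof. by move=> /hermP hX; apply/hermP; rewrite trmxC_Z hX. Qed.

Lemma herm_scalar m (c : R) : (c%:C%:M : 'M[C]_m) \is hermsymmx.
Proof. by apply/hermP; exact: trmxC_scalar. Qed.

Lemma herm_sum m (I : finType) (F : I -> 'M[C]_m) :
  (forall i, F i \is hermsymmx) -> \sum_i F i \is hermsymmx.
Proof.
by move=> hF; apply/hermP; rewrite trmxC_sum; apply: eq_bigr => i _; apply/hermP.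
Qed.

Lemma herm_congr m n (X : 'M[C]_m) (K : 'M[C]_(m, n)) :
  X \is hermsymmx -> K ^t* *m X *m K \is hermsymmx.
Proof.
by move=> /hermP hX; apply/hermP; rewrite !trmxC_M trmxCK hX mulmxA.
Qed.

Lemma herm_block m1 m2 (X : 'M[C]_m1) Y (Z : 'M[C]_m2) :
  X \is hermsymmx -> Z \is hermsymmx ->
  block_mx X Y (Y ^t*) Z \is hermsymmx.
Proof.
by move=> /hermP hX /hermP hZ; apply/hermP; rewrite trmxC_block trmxCK hX hZ.
Qed.

Lemma herm_unit_inv m (X : 'M[C]_m) :
  X \in unitmx -> X \is hermsymmx -> invmx X \is hermsymmx.
Proof.
move=> uX /hermP hX; apply/hermP.
have h : (invmx X) ^t* *m X = 1%:M.
  by rewrite -{2}hX -trmxC_M mulmxV // trmxC_1.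
by rewrite -[LHS]mulmx1 -(mulmxV uX) mulmxA h mul1mx.
Qed.

Lemma herm_tr m (X : 'M[C]_m) : X \is hermsymmx ->
  \tr X = (complex.Re (\tr X))%:C.
Proof.
move=> /hermP hX.
have : Num.conj (\tr X) = \tr X.
  rewrite -[in RHS]hX /mxtrace rmorph_sum; apply: eq_bigr => i _.
  by rewrite !mxE.
case: (\tr X) => a b [] /eqP; rewrite /= eq_sym -subr_eq0 opprK -mulr2n.
by rewrite mulrn_eq0 => /eqP ->.
Qed.

End Adjoint.

Section Pairing.
Context {R : realType}.
Local Notation C := R[i].
Implicit Types m n : nat.

Lemma mxdotEtr m (X Y : 'M[C]_m) : mxdot X Y = complex.Re (\tr (X ^t* *m Y)).
Proof. by []. Qed.

Lemma mxdotC m (X Y : 'M[C]_m) : mxdot X Y = mxdot Y X.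
Proof.
rewrite /mxdot -Re_conjc -mxtrace_tr; congr complex.Re.
rewrite raddf_sum; apply: eq_bigr => i _ /=.
rewrite !mxE rmorph_sum; apply: eq_bigr => j _ /=.
by rewrite !mxE rmorphM /= conjCK mulrC.
Qed.

Lemma mxdotDr m (X Y Z : 'M[C]_m) : mxdot X (Y + Z) = mxdot X Y + mxdot X Z.
Proof. by rewrite /mxdot mulmxDr mxtraceD ReD. Qed.

Lemma mxdotNr m (X Y : 'M[C]_m) : mxdot X (- Y) = - mxdot X Y.
Proof. by rewrite /mxdot mulmxN raddfN /= ReN. Qed.

Lemma mxdotBr m (X Y Z : 'M[C]_m) : mxdot X (Y - Z) = mxdot X Y - mxdot X Z.
Proof. by rewrite mxdotDr mxdotNr. Qed.

Lemma mxdotZr m (c : R) (X Y : 'M[C]_m) : mxdot X (c%:C *: Y) = c * mxdot X Y.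
Proof. by rewrite /mxdot -scalemxAr mxtraceZ ReZ. Qed.

Lemma mxdot0r m (X : 'M[C]_m) : mxdot X 0 = 0.
Proof. by rewrite /mxdot mulmx0 mxtrace0. Qed.

Lemma mxdot_sumr m (I : Type) (r : seq I) (P : pred I) (X : 'M[C]_m) F :
  mxdot X (\sum_(i <- r | P i) F i) = \sum_(i <- r | P i) mxdot X (F i).
Proof.
by apply: (big_morph (mxdot X)); [exact: mxdotDr | exact: mxdot0r].
Qed.

Lemma mxdotDl m (X Y Z : 'M[C]_m) : mxdot (Y + Z) X = mxdot Y X + mxdot Z X.
Proof. by rewrite mxdotC mxdotDr mxdotC (mxdotC X). Qed.

Lemma mxdotNl m (X Y : 'M[C]_m) : mxdot (- Y) X = - mxdot Y X.
Proof. by rewrite mxdotC mxdotNr mxdotC. Qed.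

Lemma mxdotBl m (X Y Z : 'M[C]_m) : mxdot (Y - Z) X = mxdot Y X - mxdot Z X.
Proof. by rewrite mxdotDl mxdotNl. Qed.

Lemma mxdotZl m (c : R) (X Y : 'M[C]_m) : mxdot (c%:C *: Y) X = c * mxdot Y X.
Proof. by rewrite mxdotC mxdotZr mxdotC. Qed.

Lemma mxdot0l m (X : 'M[C]_m) : mxdot 0 X = 0.
Proof. by rewrite mxdotC mxdot0r. Qed.

Lemma mxdot1 m (X : 'M[C]_m) : mxdot 1%:M X = complex.Re (\tr X).
Proof. by rewrite /mxdot trmxC_1 mul1mx. Qed.

Lemma mxdot_scalar m (c : R) (X : 'M[C]_m) :
  mxdot (c%:C%:M) X = c * complex.Re (\tr X).
Proof. by rewrite -scalemx1 mxdotZl mxdot1. Qed.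

Lemma mxdot_trmxC m (X Y : 'M[C]_m) : mxdot (X ^t*) (Y ^t*) = mxdot X Y.
Proof.
by rewrite mxdotC /mxdot trmxCK mxtrace_mulC.
Qed.

Lemma mxdot_block m (X X' Y Y' Z Z' W W' : 'M[C]_m) :
  mxdot (block_mx X Y Z W) (block_mx X' Y' Z' W') =
  mxdot X X' + mxdot Y Y' + mxdot Z Z' + mxdot W W'.
Proof.
rewrite /mxdot trmxC_block mulmx_block mxtrace_block !mxtraceD !ReD.
by rewrite addrCA !addrA; congr (_ + _); rewrite addrAC addrC addrA.
Qed.

Lemma mxdotE m (X Y : 'M[C]_m) :
  mxdot X Y = \sum_i \sum_j (complex.Re (X i j) * complex.Re (Y i j)
                             + complex.Im (X i j) * complex.Im (Y i j)).
Proof.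
rewrite /mxdot /mxtrace Re_sum exchange_big; apply: eq_bigr => j _ /=.
rewrite mxE Re_sum; apply: eq_bigr => i _; rewrite !mxE.
by case: (X i j) (Y i j) => [a b] [c e] /=; rewrite mulNr opprK.
Qed.

Lemma mxdot_ge0 m (X : 'M[C]_m) : 0 <= mxdot X X.
Proof.
rewrite mxdotE; apply: sumr_ge0 => i _; apply: sumr_ge0 => j _.
by rewrite -!expr2 addr_ge0 // sqr_ge0.
Qed.

Lemma mxdot_eq0 m (X : 'M[C]_m) : mxdot X X = 0 -> X = 0.
Proof.
have h i j : 0 <= complex.Re (X i j) * complex.Re (X i j) +
                  complex.Im (X i j) * complex.Im (X i j).
  by rewrite -!expr2 addr_ge0 // sqr_ge0.
rewrite mxdotE => /eqP; rewrite psumr_eq0; last first.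
  by move=> i _; apply: sumr_ge0.
move=> /allP h0; apply/matrixP => i j.
have /eqP/eqP := h0 i (mem_index_enum _).
rewrite psumr_eq0 // => /allP/(_ j (mem_index_enum _))/eqP /eqP.
rewrite -!expr2 paddr_eq0 ?sqr_ge0 // !sqrf_eq0 mxE.
by case: (X i j) => a b /= /andP[/eqP-> /eqP->].
Qed.

(** Pairing with matrix units recovers the real coordinates, so a matrix is
    determined by its pairings. *)
Lemma mxdot_delta_Re m (X : 'M[C]_m) i j :
  mxdot (delta_mx i j) X = complex.Re (X i j).
Proof.
rewrite mxdotE (bigD1 i) //= (bigD1 j) //= !big1 ?addr0.
- by rewrite !mxE !eqxx /= mul1r mul0r addr0.
- by move=> k hk; rewrite big1 // => l _; rewrite !mxE (negbTE hk) /= !mul0r addr0.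
- by move=> k hk; rewrite !mxE (negbTE hk) andbF /= !mul0r addr0.
Qed.

Lemma mxdot_delta_Im m (X : 'M[C]_m) i j :
  mxdot ('i%C *: delta_mx i j) X = complex.Im (X i j).
Proof.
rewrite mxdotE (bigD1 i) //= (bigD1 j) //= !big1 ?addr0.
- rewrite !mxE !eqxx mulr1 /=.  by rewrite mul0r add0r mul1r.
- move=> k hk; rewrite big1 // => l _; rewrite !mxE (negbTE hk) mulr0 /=.
  by rewrite !mul0r addr0.
- by move=> k hk; rewrite !mxE (negbTE hk) andbF mulr0 /= !mul0r addr0.
Qed.

Lemma mxdot_ext m (X Y : 'M[C]_m) : (forall M, mxdot M X = mxdot M Y) -> X = Y.
Proof.
move=> h; apply/eqP; rewrite -subr_eq0; apply/eqP/mxdot_eq0.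
by rewrite mxdotBr h subrr.
Qed.

End Pairing.

(** * Positive semidefinite matrices *)

Section FormCharacterization.
Context {R : realType}.
Local Notation C := R[i].
Implicit Types m n : nat.

Lemma mxdot_rank1 m (v : 'cV[C]_m) (X : 'M[C]_m) :
  mxdot (v *m v ^t*) X = complex.Re ((v ^t* *m X *m v) 0 0).
Proof.
by rewrite /mxdot trmxC_M trmxCK -mulmxA mxtrace_mulC /mxtrace big_ord1.
Qed.

Lemma herm_form_real m (X : 'M[C]_m) (v : 'cV[C]_m) : X \is hermsymmx ->
  complex.Im ((v ^t* *m X *m v) 0 0) = 0.
Proof.
move=> /(herm_congr v)/herm_trmxC/matrixP/(_ 0 0); rewrite !mxE /=.
case: (\sum_j _) => a b [] /eqP; rewrite /= eq_sym -subr_eq0 opprK -mulr2n.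
by rewrite mulrn_eq0 => /eqP.
Qed.

(** The form of a Hermitian matrix takes real values, so a condition on real
    parts suffices; v v^* is the test matrix that turns the form into a pairing. *)
Lemma psdP m (X : 'M[C]_m) : psdmx X <->
  X \is hermsymmx /\ forall v : 'cV[C]_m, 0 <= mxdot (v *m v ^t*) X.
Proof.
split=> -[hX h]; split=> // v.
  by have := h v; rewrite lecE mxdot_rank1 => /andP[].
by rewrite lecE herm_form_real // eqxx -mxdot_rank1 h.
Qed.

Lemma pdP m (X : 'M[C]_m) : pdmx X <->
  X \is hermsymmx /\ forall v : 'cV[C]_m, v != 0 -> 0 < mxdot (v *m v ^t*) X.
Proof.
split=> -[hX h]; split=> // v v0.
  by have := h v v0; rewrite ltcE mxdot_rank1 => /andP[].
by rewrite ltcE herm_form_real // eqxx -mxdot_rank1 h.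
Qed.

Lemma psd_herm m (X : 'M[C]_m) : psdmx X -> X \is hermsymmx.
Proof. by case. Qed.

Lemma psd_congr m n (X : 'M[C]_m) (K : 'M[C]_(m, n)) :
  psdmx X -> psdmx (K ^t* *m X *m K).
Proof.
move=> [hX pX]; split=> [|v]; first exact: herm_congr.
have := pX (K *m v); rewrite trmxC_M !mulmxA; exact.
Qed.

End FormCharacterization.

(* From here on psdP, pdP and psd_congr are the interface: comparing two of
   these predicates by unfolding would descend to the matrix entries. *)
Opaque psdmx pdmx mxdot.

Section PSD.
Context {R : realType}.
Local Notation C := R[i].
Implicit Types m n : nat.

Lemma pd_psd m (X : 'M[C]_m) : pdmx X -> psdmx X.
Proof.
move=> /pdP[hX h]; apply/psdP; split=> // v.
have [->|/h/ltW//] := eqVneq v 0; by rewrite mul0mx mxdot0l.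
Qed.

Lemma not_psd m (X : 'M[C]_m) : X \is hermsymmx -> ~ psdmx X ->
  exists v : 'cV[C]_m, mxdot (v *m v ^t*) X < 0.
Proof.
move=> hX nX; apply/not_existsP => h; apply: nX; apply/psdP; split=> // v.
by rewrite leNgt; apply/negP/h.
Qed.

Lemma psd0 m : psdmx (0 : 'M[C]_m).
Proof. by apply/psdP; split=> [|v]; [exact: herm0 | rewrite mxdot0r]. Qed.

Lemma psdD m (X Y : 'M[C]_m) : psdmx X -> psdmx Y -> psdmx (X + Y).
Proof.
move=> /psdP[hX pX] /psdP[hY pY]; apply/psdP; split=> [|v]; first exact: hermD.
by rewrite mxdotDr addr_ge0.
Qed.

Lemma pdD_psd m (X Y : 'M[C]_m) : pdmx X -> psdmx Y -> pdmx (X + Y).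
Proof.
move=> /pdP[hX pX] /psdP[hY pY]; apply/pdP; split=> [|v v0]; first exact: hermD.
by rewrite mxdotDr ltr_wpDr // pX.
Qed.

Lemma psdZ m (c : R) (X : 'M[C]_m) : 0 <= c -> psdmx X -> psdmx (c%:C *: X).
Proof.
move=> c0 /psdP[hX pX]; apply/psdP; split=> [|v]; first exact: hermZ.
by rewrite mxdotZr mulr_ge0.
Qed.

Lemma psd_sum m (I : finType) (P : pred I) (F : I -> 'M[C]_m) :
  (forall i, psdmx (F i)) -> psdmx (\sum_(i | P i) F i).
Proof.
by move=> h; apply: big_ind => [|X Y|i _]; [exact: psd0 | exact: psdD | exact: h].
Qed.

Lemma psd1 m : psdmx (1%:M : 'M[C]_m).
Proof.
apply/psdP; split=> [|v]; first exact: (herm_scalar m 1).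
rewrite mxdotC mxdot1 mxtrace_mulC /mxtrace big_ord1 mxE Re_sum.
apply: sumr_ge0 => i _; rewrite !mxE; case: (v i 0) => a b /=.
by rewrite mulNr opprK -!expr2 addr_ge0 // sqr_ge0.
Qed.

Lemma psd_gram m n (K : 'M[C]_(m, n)) : psdmx (K ^t* *m K).
Proof. by have := psd_congr K (psd1 m); rewrite mulmx1. Qed.

Lemma psd_scalar m (c : R) : 0 <= c -> psdmx (c%:C%:M : 'M[C]_m).
Proof. by move=> c0; rewrite -scalemx1; apply: psdZ => //; exact: psd1. Qed.

Lemma psd_rank1 m (v : 'cV[C]_m) : psdmx (v *m v ^t*).
Proof. by have := psd_gram (v ^t*); rewrite trmxCK. Qed.

(** A row u of the kernel of X would be a null vector u^* of its form. *)
Lemma pd_unit m (X : 'M[C]_m) : pdmx X -> X \in unitmx.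
Proof.
move=> /pdP[hX pX]; rewrite -row_free_unit -kermx_eq0.
apply/eqP/row_matrixP => i; rewrite row0; apply/eqP/negPn/negP => u0.
have uX : row i (kermx X) *m X = 0.
  by apply/sub_kermxP; exact: row_sub.
have v0 : (row i (kermx X)) ^t* != 0.
  apply: contra u0 => /eqP h; rewrite -[row _ _]trmxCK h trmxC_0 //.
by have := pX _ v0; rewrite mxdot_rank1 trmxCK uX mul0mx mxE ltxx.
Qed.

Lemma pd_scalar m (c : R) : 0 < c -> pdmx (c%:C%:M : 'M[C]_m).
Proof.
move=> c0; apply/pdP; split=> [|v v0]; first exact: herm_scalar.
rewrite mxdotC mxdot_scalar pmulr_rgt0 //.
rewrite lt_neqAle -mxdot1 mxdotC.
have /psdP[_ ->] := psd1 m; rewrite andbT eq_sym; apply: contra v0 => /eqP.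
rewrite mxdotC mxdot1 mxtrace_mulC => h.
apply/eqP; have /(@mxdot_eq0 R m) : mxdot (v *m v ^t*) (v *m v ^t*) = 0.
  rewrite mxdot_rank1 mulmxA -mulmxA.
  have -> : v ^t* *m v = 0.
    apply/matrixP => i j; rewrite !ord1 [RHS]mxE.
    have := herm_form_real v (herm_scalar m 1); rewrite mulmx1.
    move: h; rewrite /mxtrace big_ord1.
    by case: ((_ *m _) 0 0) => a b /= -> ->.
  by rewrite mulmx0 mxE.
move=> h2; apply/matrixP => i j; rewrite ord1 [RHS]mxE.
have /matrixP/(_ i i) := h2; rewrite !mxE big_ord1 !mxE => /eqP.
by rewrite mulf_eq0 conjC_eq0 orbb => /eqP.
Qed.

End PSD.

Section Spectral.
Context {R : realType}.
Local Notation C := R[i].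
Implicit Types m n : nat.

Definition real_diag m (e : 'rV[R]_m) : 'M[C]_m :=
  diag_mx (map_mx (real_complex R) e).

Lemma herm_real_diag m (e : 'rV[R]_m) : real_diag e \is hermsymmx.
Proof.
apply/hermP; rewrite /real_diag tr_diag_mx map_diag_mx; congr diag_mx.
by apply/rowP => j; rewrite !mxE; apply: conj_realC.
Qed.

Lemma real_diagM m (e f : 'rV[R]_m) :
  real_diag e *m real_diag f = real_diag (\row_j (e 0 j * f 0 j)).
Proof.
rewrite /real_diag mulmx_diag; congr diag_mx.
by apply/rowP => j; rewrite !mxE rmorphM.
Qed.

Lemma real_diag_const m (c : R) : real_diag (const_mx c : 'rV_m) = c%:C%:M.
Proof.
by rewrite /real_diag -diag_const_mx; congr diag_mx; apply/rowP => j; rewrite !mxE.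
Qed.

Lemma real_diagD m (e f : 'rV[R]_m) :
  real_diag (e + f) = real_diag e + real_diag f.
Proof. by rewrite /real_diag map_mxD raddfD. Qed.

Lemma mxdot_real_diag m (e : 'rV[R]_m) (v : 'cV[C]_m) :
  mxdot (v *m v ^t*) (real_diag e) =
  \sum_j e 0 j * (complex.Re (v j 0) ^+ 2 + complex.Im (v j 0) ^+ 2).
Proof.
rewrite mxdot_rank1 mul_mx_diag mxE Re_sum; apply: eq_bigr => j _.
rewrite !mxE; case: (v j 0) => a b /=; ring.
Qed.

Lemma psd_real_diag m (e : 'rV[R]_m) :
  (forall j, 0 <= e 0 j) -> psdmx (real_diag e).
Proof.
move=> e0; apply/psdP; split=> [|v]; first exact: herm_real_diag.
rewrite mxdot_real_diag sumr_ge0 // => j _.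
by rewrite mulr_ge0 // addr_ge0 // sqr_ge0.
Qed.

Lemma herm_spectral m (X : 'M[C]_m) : X \is hermsymmx ->
  exists U (e : 'rV[R]_m), [/\ U *m U ^t* = 1%:M, U ^t* *m U = 1%:M
                & X = U ^t* *m real_diag e *m U].
Proof.
move=> hX; have /hermitian_normalmx/orthomx_spectralP := hX.
have := hermitian_spectral_diag_real hX.
have := spectral_unitarymx X.
move: (spectralmx X) (spectral_diag X) => U D unU rD XE.
exists U, (map_mx (@complex.Re R) D).
have UU : U *m U ^t* = 1%:M by apply/unitarymxP.
split; [exact: UU | exact: (mulmx1C UU) |].
rewrite [LHS]XE (invmx_unitary unU) /real_diag.
have -> // : map_mx (real_complex R) (map_mx (@complex.Re R) D) = D.
by apply/rowP => j; rewrite !mxE; apply/RRe_real; have /mxOverP := rD; apply.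
Qed.

Lemma psd_diag_ge0 m (U : 'M[C]_m) e : U *m U ^t* = 1%:M ->
  psdmx (U ^t* *m real_diag e *m U) -> forall j, 0 <= e 0 j.
Proof.
move=> UU /(psd_congr (U ^t*)); rewrite trmxCK !mulmxA UU mul1mx -mulmxA UU mulmx1.
move=> /psdP[_ h] j; have := h (delta_mx j 0).
rewrite mxdot_real_diag (bigD1 j) //= big1 => [|k /negbTE kj].
  by rewrite !mxE !eqxx /= expr1n expr0n /= !addr0 mulr1.
by rewrite !mxE kj /= expr0n addr0 mulr0.
Qed.

Lemma unitary_congrM m (U : 'M[C]_m) (g h : 'rV[R]_m) : U *m U ^t* = 1%:M ->
  (U ^t* *m real_diag g *m U) *m (U ^t* *m real_diag h *m U) =
  U ^t* *m real_diag (\row_j (g 0 j * h 0 j)) *m U.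
Proof.
move=> UU; rewrite -real_diagM -!mulmxA; do 2!congr (_ *m _).
by rewrite (mulmxA U) UU mul1mx.
Qed.

Lemma psd_root m (X : 'M[C]_m) : psdmx X -> exists B, psdmx B /\ B *m B = X.
Proof.
move=> pX; have [U [e [UU UU' XE]]] := herm_spectral (psd_herm pX).
have e0 : forall j, 0 <= e 0 j by apply: (psd_diag_ge0 UU); rewrite -XE.
exists (U ^t* *m real_diag (\row_j Num.sqrt (e 0 j)) *m U); split.
  by apply/psd_congr/psd_real_diag => j; rewrite mxE sqrtr_ge0.
rewrite unitary_congrM // XE; set f := \row_j _.
have -> // : f = e by apply/rowP => j; rewrite !mxE -expr2 sqr_sqrtr.
Qed.

(** With square roots B of X and K of Y, tr (X Y) is the squared norm of K B. *)
Lemma psd_dot_ge0 m (X Y : 'M[C]_m) : psdmx X -> psdmx Y -> 0 <= mxdot X Y.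
Proof.
move=> /psd_root[B [/psd_herm/herm_trmxC hB <-]] pY.
have [K [/psd_herm/herm_trmxC hK <-]] := psd_root pY.
rewrite mxdotEtr trmxC_M hB -mulmxA mxtrace_mulC.
have -> : B *m (K *m K) *m B = (K *m B) ^t* *m (K *m B).
  by rewrite trmxC_M hB hK !mulmxA.
by rewrite -mxdotEtr mxdot_ge0.
Qed.

Lemma psd_tr_ge0 m (X : 'M[C]_m) : psdmx X -> 0 <= complex.Re (\tr X).
Proof. by move=> pX; rewrite -mxdot1; exact: psd_dot_ge0 (psd1 m) pX. Qed.

Lemma psd_tr_eq0 m (X : 'M[C]_m) : psdmx X -> complex.Re (\tr X) = 0 -> X = 0.
Proof.
move=> /psd_root[B [/psd_herm/herm_trmxC hB <-]].
by rewrite -{1}hB -mxdotEtr => /mxdot_eq0 ->; rewrite mulmx0.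
Qed.

(** With D = A - B one has A D = - D B, so tr (D A D) + tr (D B D) = 0; both
    traces are nonnegative, hence D A D = D B D = 0 and D^3 = 0. *)
Lemma psd_root_uniq m (A B : 'M[C]_m) :
  psdmx A -> psdmx B -> A *m A = B *m B -> A = B.
Proof.
move=> pA pB AB; pose D := A - B.
have hD : D ^t* = D by apply: herm_trmxC; apply: hermB; exact: psd_herm.
have pDA : psdmx (D *m A *m D) by have := psd_congr D pA; rewrite hD.
have pDB : psdmx (D *m B *m D) by have := psd_congr D pB; rewrite hD.
have h : A *m D + D *m B = 0.
  by rewrite mulmxBr mulmxBl AB addrA subrK subrr.
have trs : complex.Re (\tr (D *m A *m D)) + complex.Re (\tr (D *m B *m D)) = 0.
  rewrite -ReD (mxtrace_mulC (D *m B)) -mulmxA -mxtraceD -mulmxDr h.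
  by rewrite mulmx0 mxtrace0.
have [a0 b0] : complex.Re (\tr (D *m A *m D)) = 0 /\
               complex.Re (\tr (D *m B *m D)) = 0.
  move: trs => /eqP; rewrite paddr_eq0 ?psd_tr_ge0 // => /andP[/eqP ? /eqP ?] //.
have DDD : D *m D *m D = 0.
  have -> : D *m D *m D = D *m A *m D - D *m B *m D.
    by rewrite -mulmxBl -mulmxBr.
  by rewrite (psd_tr_eq0 pDA a0) (psd_tr_eq0 pDB b0) subrr.
have D2 : D *m D = 0.
  by apply: mxdot_eq0; rewrite mxdotEtr trmxC_M hD mulmxA DDD mul0mx mxtrace0.
apply/eqP; rewrite -subr_eq0 -/D; apply/eqP/mxdot_eq0.
by rewrite mxdotEtr hD D2 mxtrace0.
Qed.

Lemma sqrtmxP m (X : 'M[C]_m) : psdmx X ->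
  psdmx (sqrtmx X) /\ sqrtmx X *m sqrtmx X = X.
Proof. by move=> /psd_root[B hB]; rewrite /sqrtmx; case: xgetP => [y _ []|/(_ B)]. Qed.

Lemma sqrtmx_eq m (X B : 'M[C]_m) : psdmx B -> B *m B = X -> sqrtmx X = B.
Proof.
move=> pB BX; have pX : psdmx X.
  by have := psd_gram B; rewrite (herm_trmxC (psd_herm pB)) BX.
have [pS SX] := sqrtmxP pX.
by apply: psd_root_uniq; rewrite // SX BX.
Qed.

(** The eigenvector is normalized in order that v v^* be a matrix of trace 1,
    as required of the variables of the dual program. *)
Lemma herm_top m (X : 'M[C]_m) : (0 < m)%N -> X \is hermsymmx ->
  exists c : R, exists v : 'cV[C]_m,
    [/\ X *m v = c%:C *: v, complex.Re (\tr (v *m v ^t*)) = 1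
      & psdmx (c%:C%:M - X)].
Proof.
case: m X => // m X _ hX; have [U [e [UU UU' XE]]] := herm_spectral hX.
pose j0 := [arg max_(j > ord0) e 0 j]%O.
have je j : e 0 j <= e 0 j0 by rewrite /j0; case: Order.TotalTheory.arg_maxP => // k _; apply.
exists (e 0 j0), (U ^t* *m delta_mx j0 0); split.
- rewrite XE !mulmxA -(mulmxA _ U (U ^t*)) UU mulmx1 -mulmxA scalemxAr.
  congr (_ *m _); apply/matrixP => i j.
  rewrite mul_diag_mx !mxE; case: eqP => [->|_] /=; first by [].
  by rewrite !mulr0.
- rewrite mxtrace_mulC trmxC_M trmxCK !mulmxA -(mulmxA _ U) UU mulmx1.
  rewrite trmx_delta /mxtrace big_ord1 mxE (bigD1 j0) //= big1.
    by rewrite !mxE !eqxx /= mulr0 subr0 mulr1 addr0.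
  by move=> k /negbTE kj; rewrite !mxE kj /= mulr0.
have -> : (e 0 j0)%:C%:M - X = U ^t* *m real_diag (const_mx (e 0 j0) - e) *m U.
  rewrite real_diagD -real_diag_const.
  have -> : real_diag (- e) = - real_diag e.
    by rewrite /real_diag map_mxN raddfN.
  rewrite mulmxDr mulmxDl mulmxN mulNmx -XE real_diag_const.
  by rewrite -scalemx1 -scalemxAr mulmx1 -scalemxAl UU'.
by apply/psd_congr/psd_real_diag => j; rewrite !mxE subr_ge0.
Qed.

Lemma mxdot_eigen m (X : 'M[C]_m) (c : R) (v : 'cV[C]_m) :
  X *m v = c%:C *: v -> complex.Re (\tr (v *m v ^t*)) = 1 ->
  mxdot (v *m v ^t*) X = c.
Proof.
move=> Xv v1; rewrite mxdot_rank1 -mulmxA Xv -scalemxAr mxE ReZ.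
by move: v1; rewrite mxtrace_mulC /mxtrace big_ord1 => ->; rewrite mulr1.
Qed.

(** The supremum is attained at the top eigenvalue, so a bound on lambda_max
    is a Loewner inequality, which is how the programs express it. *)
Lemma lambda_maxP m (X : 'M[C]_m) : (0 < m)%N -> X \is hermsymmx ->
  psdmx ((lambda_max X)%:C%:M - X) /\
  forall c : R, psdmx (c%:C%:M - X) -> lambda_max X <= c.
Proof.
move=> m0 hX; have [c [v [Xv v1 pc]]] := herm_top m0 hX.
pose E := [set x : R | eigenvalue X x%:C].
have v0 : v != 0.
  apply: contra_eqN v1 => /eqP ->; rewrite mul0mx mxtrace0 /= eq_sym.
  exact: oner_neq0.
have Ec : E c.
  apply/eigenvalueP; exists (v ^t*).
    by have := congr1 (fun Y : 'M__ => Y ^t*) Xv; rewrite trmxC_M trmxC_Z herm_trmxC.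
  by apply: contra v0 => /eqP h; rewrite -[v]trmxCK h trmxC_0.
have Eub (b : R) : psdmx (b%:C%:M - X) -> ubound E b.
  move=> /psdP[_ pb] x /eigenvalueP[u uX u0].
  have u0' : u ^t* != 0.
    by apply: contra u0 => /eqP h; rewrite -[u]trmxCK h trmxC_0.
  have /pdP[_ /(_ _ u0')] := pd_scalar m (@ltr01 R).
  have := pb (u ^t*); rewrite mxdotBr !(mxdotC _ (_%:C%:M)) !mxdot_scalar mul1r.
  rewrite mxdot_rank1 trmxCK uX -scalemxAl mxE ReZ.
  have -> : (u *m u ^t*) 0 0 = \tr (u ^t* *m u).
    by rewrite mxtrace_mulC /mxtrace big_ord1.
  by rewrite -mulrBl => h tp; move: h; rewrite pmulr_lge0 // subr_ge0.
(* Both bounds of lambda_max come from c itself: it is an eigenvalue, and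
   c I - X is positive semidefinite. *)
have -> : lambda_max X = c.
  apply/eqP; rewrite eq_le; apply/andP; split.
    by apply: ge_sup; [exists c | exact: Eub].
  by apply: ub_le_sup => //; exists c; exact: Eub.
by split=> // b /Eub; apply.
Qed.

End Spectral.

(** * Compactness of families of positive semidefinite matrices *)

Import numFieldNormedType.Exports.

Section Families.
Context {R : realType} {m : nat} {T : finType}.
Local Notation C := R[i].
Local Notation family := (T -> 'M[C]_m).

Local Notation coord := (T * 'I_m * 'I_m * bool)%type.
Definition coords := prod_topology (fun _ : coord => R).

(** Real and imaginary parts of all entries: in these coordinates Tychonoff's
    theorem provides compact boxes. *)
Definition of_coords (p : coords) : family :=
  fun t => \matrix_(i, j) (p (t, i, j, false) +i* p (t, i, j, true)).

Definition to_coords (X : family) : coords :=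
  fun q : coord => let: (t, i, j, b) := q in
    if b then complex.Im (X t i j) else complex.Re (X t i j).

Lemma to_coordsK X : of_coords (to_coords X) = X.
Proof.
by apply/funext => t; apply/matrixP => i j; rewrite mxE /=; case: (X t i j).
Qed.

Record fam_closed (F : set family) : Prop := FamClosed {
  fam_closedE : closed (of_coords @^-1` F : set coords) }.

Record fam_continuous (f : family -> R) : Prop := FamContinuous {
  fam_continuousE : continuous (fun p : coords => f (of_coords p) : R) }.

(** Continuity tested against all matrices, the form in which equations and
    semidefinite constraints are turned into conditions on real numbers. *)
Record fam_mx_continuous k (F : family -> 'M[C]_k) : Prop := FamMxContinuous {
  fam_mx_continuousE : forall M, fam_continuous (fun X => mxdot M (F X)) }.

Lemma fam_continuous_ext f g : fam_continuous f -> f =1 g -> fam_continuous g.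
Proof. by move=> cf /funext <-. Qed.

Lemma fam_continuous_cst (c : R) : fam_continuous (fun=> c).
Proof. by constructor; exact: (@cst_continuous coords R c). Qed.

Lemma fam_continuousD f g : fam_continuous f -> fam_continuous g ->
  fam_continuous (fun X => f X + g X).
Proof. by move=> [cf] [cg]; constructor=> p; exact: (@continuousD R R coords _ _ p (cf p) (cg p)). Qed.

Lemma fam_continuousN f : fam_continuous f -> fam_continuous (fun X => - f X).
Proof. by move=> [cf]; constructor=> p; exact: (@continuousN R R coords _ p (cf p)). Qed.

Lemma fam_continuousB f g : fam_continuous f -> fam_continuous g ->
  fam_continuous (fun X => f X - g X).
Proof. by move=> cf cg; apply: fam_continuousD => //; exact: fam_continuousN. Qed.

Lemma fam_continuousM f g : fam_continuous f -> fam_continuous g ->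
  fam_continuous (fun X => f X * g X).
Proof. by move=> [cf] [cg]; constructor=> p; exact: (@continuousM R coords _ _ p (cf p) (cg p)). Qed.

Lemma fam_continuous_sum (I : Type) (r : seq I) (F : I -> family -> R) :
  (forall i, fam_continuous (F i)) ->
  fam_continuous (fun X => \sum_(i <- r) F i X).
Proof.
move=> cF; elim: r => [|i r IH].
  by apply: (fam_continuous_ext (@fam_continuous_cst 0)) => X; rewrite big_nil.
by apply: (fam_continuous_ext (fam_continuousD (cF i) IH)) => X; rewrite big_cons.
Qed.

Lemma fam_continuous_Re t i j : fam_continuous (fun X => complex.Re (X t i j)).
Proof.
constructor; under [X in continuous X]funext do rewrite mxE /=.
exact: (@proj_continuous coord (fun=> R) (t, i, j, false)).
Qed.

Lemma fam_continuous_Im t i j : fam_continuous (fun X => complex.Im (X t i j)).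
Proof.
constructor; under [X in continuous X]funext do rewrite mxE /=.
exact: (@proj_continuous coord (fun=> R) (t, i, j, true)).
Qed.

Lemma fam_mx_continuous_proj t : fam_mx_continuous (fun X => X t).
Proof.
constructor=> M; under [fun X => _]eq_fun do rewrite mxdotE.
apply: fam_continuous_sum => i; apply: fam_continuous_sum => j.
apply: fam_continuousD; apply: fam_continuousM;
  by [exact: fam_continuous_cst | exact: fam_continuous_Re
     | exact: fam_continuous_Im].
Qed.

Lemma fam_mx_continuous_cst k (M : 'M[C]_k) : fam_mx_continuous (fun=> M).
Proof. by constructor=> N; exact: fam_continuous_cst. Qed.

Lemma fam_mx_continuousD k (F G : family -> 'M[C]_k) :
  fam_mx_continuous F -> fam_mx_continuous G ->
  fam_mx_continuous (fun X => F X + G X).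
Proof.
move=> [cF] [cG]; constructor=> M; apply: (fam_continuous_ext (fam_continuousD (cF M) (cG M))) => X.
by rewrite mxdotDr.
Qed.

Lemma fam_mx_continuousB k (F G : family -> 'M[C]_k) :
  fam_mx_continuous F -> fam_mx_continuous G ->
  fam_mx_continuous (fun X => F X - G X).
Proof.
move=> [cF] [cG]; constructor=> M; apply: (fam_continuous_ext (fam_continuousB (cF M) (cG M))) => X.
by rewrite mxdotBr.
Qed.

Lemma fam_mx_continuous_sum k (I : Type) (r : seq I) (F : I -> family -> 'M[C]_k) :
  (forall i, fam_mx_continuous (F i)) ->
  fam_mx_continuous (fun X => \sum_(i <- r) F i X).
Proof.
move=> cF; constructor=> M; apply: (fam_continuous_ext (fam_continuous_sum r (fun i => fam_mx_continuousE (cF i) M))) => X.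
by rewrite mxdot_sumr.
Qed.

Lemma fam_mx_continuous_scalar k (f : family -> R) :
  fam_continuous f -> fam_mx_continuous (fun X => (f X)%:C%:M : 'M[C]_k).
Proof.
move=> cf; constructor=> M.
apply: (fam_continuous_ext (fam_continuousM cf (@fam_continuous_cst (complex.Re (\tr M))))).
by move=> X; rewrite mxdotC mxdot_scalar.
Qed.

Lemma fam_mx_continuous_block k (F G : family -> 'M[C]_k) (B B' : 'M[C]_k) :
  fam_mx_continuous F -> fam_mx_continuous G ->
  fam_mx_continuous (fun X => block_mx (F X) B B' (G X)).
Proof.
move=> [cF] [cG]; constructor=> M; rewrite -[M]submxK.
under [fun X => _]eq_fun do rewrite mxdot_block.
apply: fam_continuousD => //; apply: fam_continuousD; last exact: fam_continuous_cst.
by apply: fam_continuousD => //; exact: fam_continuous_cst.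
Qed.

Lemma fam_mx_continuous_ulsub k (F : family -> 'M[C]_(k + k)) :
  fam_mx_continuous F -> fam_mx_continuous (fun X => ulsubmx (F X)).
Proof.
move=> [cF]; constructor=> M; apply: (fam_continuous_ext (cF (block_mx M 0 0 0))) => X.
by rewrite -{1}[F X]submxK mxdot_block !mxdot0l !addr0.
Qed.

Lemma fam_mx_continuous_drsub k (F : family -> 'M[C]_(k + k)) :
  fam_mx_continuous F -> fam_mx_continuous (fun X => drsubmx (F X)).
Proof.
move=> [cF]; constructor=> M; apply: (fam_continuous_ext (cF (block_mx 0 0 0 M))) => X.
by rewrite -{1}[F X]submxK mxdot_block !mxdot0l !add0r.
Qed.

Lemma fam_mx_continuous_ursub k (F : family -> 'M[C]_(k + k)) :
  fam_mx_continuous F -> fam_mx_continuous (fun X => ursubmx (F X)).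
Proof.
move=> [cF]; constructor=> M; apply: (fam_continuous_ext (cF (block_mx 0 M 0 0))) => X.
by rewrite -{1}[F X]submxK mxdot_block !mxdot0l !addr0 add0r.
Qed.

Lemma fam_continuous_Re_tr k (F : family -> 'M[C]_k) :
  fam_mx_continuous F -> fam_continuous (fun X => complex.Re (\tr (F X))).
Proof.
by move=> [cF]; apply: (fam_continuous_ext (cF 1%:M)) => X; rewrite mxdot1.
Qed.

Lemma fam_continuous_sqr k (F : family -> 'M[C]_k) :
  fam_mx_continuous F -> fam_continuous (fun X => mxdot (F X) (F X)).
Proof.
move=> [cF]; under [fun X => _]eq_fun do rewrite mxdotE.
apply: fam_continuous_sum => i; apply: fam_continuous_sum => j.
have cRe := fam_continuous_ext (cF _) (fun X => mxdot_delta_Re (F X) i j).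
have cIm := fam_continuous_ext (cF _) (fun X => mxdot_delta_Im (F X) i j).
by apply: fam_continuousD; apply: fam_continuousM.
Qed.

Lemma fam_closedI (F G : set family) :
  fam_closed F -> fam_closed G -> fam_closed (F `&` G).
Proof. by move=> [cF] [cG]; constructor; rewrite preimage_setI; exact: closedI. Qed.

Lemma fam_closedT : fam_closed setT.
Proof. by constructor; rewrite preimage_setT; exact: closedT. Qed.

Lemma fam_closed_forall (I : Type) (F : I -> set family) :
  (forall i, fam_closed (F i)) -> fam_closed [set X | forall i, F i X].
Proof.
move=> cF; constructor.
have := @closed_bigI _ _ setT _ (fun i _ => fam_closedE (cF i)).
by congr closed; apply/seteqP; split=> p /= h i; have := h i; try exact.
Qed.

Lemma fam_closed_ge0 f : fam_continuous f -> fam_closed [set X | 0 <= f X].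
Proof.
by move=> [cf]; constructor; apply: closed_comp (@closed_ge R 0) => p _; exact: cf.
Qed.

Lemma fam_closed_le f g : fam_continuous f -> fam_continuous g ->
  fam_closed [set X | f X <= g X].
Proof.
move=> cf cg; have := fam_closed_ge0 (fam_continuousB cg cf).
by congr fam_closed; apply/seteqP; split=> X /=; rewrite subr_ge0.
Qed.

Lemma fam_closed_eq f g : fam_continuous f -> fam_continuous g ->
  fam_closed [set X | f X = g X].
Proof.
move=> cf cg; have := fam_closedI (fam_closed_le cf cg) (fam_closed_le cg cf).
congr fam_closed; apply/seteqP; split=> X /= => [[fg gf]|->//].
by apply/eqP; rewrite eq_le fg.
Qed.

Lemma fam_closed_mx_eq k (F G : family -> 'M[C]_k) :
  fam_mx_continuous F -> fam_mx_continuous G ->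
  fam_closed [set X | F X = G X].
Proof.
move=> cF cG.
have := fam_closed_forall (fun M => fam_closed_eq (fam_mx_continuousE cF M) (fam_mx_continuousE cG M)).
congr fam_closed; apply/seteqP; split=> X /=; [exact: mxdot_ext | by move=> ->].
Qed.

(** A semidefinite constraint is an intersection of closed half-spaces, one for
    each v, with the closed condition of being Hermitian. *)
Lemma fam_closed_psd k (F : family -> 'M[C]_k) :
  fam_mx_continuous F -> fam_closed [set X | psdmx (F X)].
Proof.
move=> cF.
have cF' : fam_mx_continuous (fun X => (F X) ^t*).
  constructor=> M; apply: (fam_continuous_ext (fam_mx_continuousE cF (M ^t*))) => X.
  by rewrite -mxdot_trmxC trmxCK.
have := fam_closedI (fam_closed_mx_eq cF' cF)
  (fam_closed_forall (fun v : 'cV_k => fam_closed_ge0 (fam_mx_continuousE cF (v *m v ^t*)))).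
congr fam_closed; apply/seteqP; split=> X /=.
  by move=> [/hermP hX pX]; apply/psdP.
by move=> /psdP[/hermP].
Qed.

(** The form of X at the vector e_i + w e_j. *)
Lemma psd_pair_ge0 k (X : 'M[C]_k) (i j : 'I_k) (w : C) : psdmx X ->
  w * Num.conj w = 1 ->
  0 <= complex.Re (X i i) + complex.Re (X j j)
       + mxdot (Num.conj w *: delta_mx i j) X + mxdot (w *: delta_mx j i) X.
Proof.
move=> /psdP[_ pX] w1.
have := pX (delta_mx i (0 : 'I_1) + w *: delta_mx j 0).
have -> : (delta_mx i 0 + w *: delta_mx j 0) *m
    (delta_mx i (0 : 'I_1) + w *: delta_mx j 0) ^t* =
    delta_mx i i + delta_mx j j + Num.conj w *: delta_mx i j + w *: delta_mx j i.
  rewrite trmxC_D linearZ /= map_mxZ /= !trmx_delta.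
  rewrite !(map_delta_mx, mulmxDl, mulmxDr) -?scalemxAl -?scalemxAr.
  rewrite !mul_delta_mx scalerA w1 scale1r.
  by rewrite -!addrA; congr (_ + _); rewrite [in RHS]addrC -!addrA; congr (_ + _).
by rewrite !mxdotDl !mxdot_delta_Re.
Qed.

Lemma psd_diag_entry k (X : 'M[C]_k) i : psdmx X -> 0 <= complex.Re (X i i).
Proof.
move=> /psdP[_ /(_ (delta_mx i 0))].
by rewrite trmx_delta map_delta_mx mul_delta_mx mxdot_delta_Re.
Qed.

Lemma psd_diag_le_tr k (X : 'M[C]_k) i : psdmx X ->
  complex.Re (X i i) <= complex.Re (\tr X).
Proof.
move=> pX; rewrite /mxtrace Re_sum (bigD1 i) //= lerDl.
by apply: sumr_ge0 => j _; exact: psd_diag_entry.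
Qed.

(** The values w = 1, -1, i, -i of psd_pair_ge0 bound the real and imaginary
    parts of X i j by the mean of X i i and X j j. *)
Lemma psd_entry_le k (X : 'M[C]_k) (B : R) i j : psdmx X ->
  complex.Re (\tr X) <= B ->
  `|complex.Re (X i j)| <= B /\ `|complex.Im (X i j)| <= B.
Proof.
move=> pX trB.
have hX : X j i = Num.conj (X i j).
  by have /matrixP/(_ j i) := herm_trmxC (psd_herm pX); rewrite !mxE.
have di := psd_diag_le_tr i pX; have dj := psd_diag_le_tr j pX.
have ii : 'i%C * Num.conj ('i%C : C) = 1.
  by apply/eqP; rewrite eq_complex /=; apply/andP; split; apply/eqP; ring.
have conji : Num.conj ('i%C : C) = - 'i%C.
  by apply/eqP; rewrite eq_complex /= oppr0 !eqxx.
have h1 := @psd_pair_ge0 _ X i j 1 pX.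
have h2 := @psd_pair_ge0 _ X i j (-1) pX.
have h3 := @psd_pair_ge0 _ X i j 'i%C pX ii.
have h4 := @psd_pair_ge0 _ X i j (- 'i%C) pX.
rewrite rmorph1 mulr1 !scale1r !mxdot_delta_Re hX Re_conjc in h1.
rewrite rmorphN rmorph1 mulrNN mulr1 !scaleN1r !mxdotNl !mxdot_delta_Re hX Re_conjc in h2.
rewrite conji !scaleNr !mxdotNl !mxdot_delta_Im hX in h3.
have conjNi : Num.conj (- 'i%C : C) = 'i%C.
  by apply/eqP; rewrite eq_complex /= oppr0 opprK !eqxx.
have iNi : - 'i%C * 'i%C = 1 :> C by rewrite mulrC -conji.
rewrite conjNi iNi !scaleNr !mxdotNl !mxdot_delta_Im hX in h4.
have Im_conj : complex.Im (Num.conj (X i j)) = - complex.Im (X i j) by case: (X i j).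
rewrite Im_conj in h3 h4.
move: (h1 erefl) (h2 erefl) h3 (h4 erefl) => {}h1 {}h2 h3 {}h4.
by rewrite !ler_norml; split; apply/andP; split; lra.
Qed.

(** The traces bound all coordinates, so that F is a closed subset of a compact
    box, where a continuous function has a minimum. *)
Lemma psd_family_min (F : set family) (B : R) (f : family -> R) :
  F !=set0 -> fam_closed F ->
  (forall X t, F X -> psdmx (X t) /\ complex.Re (\tr (X t)) <= B) ->
  fam_continuous f ->
  exists2 X, F X & forall Y, F Y -> f X <= f Y.
Proof.
move=> [X0 FX0] cF bF cf.
have cpt : compact (of_coords @^-1` F : set coords).
  apply: (subclosed_compact (fam_closedE cF) (tychonoff (fun _ : coord => @segment_compact R (- B) B))).
  move=> p Fp [[[t i] j] b] /=.
  have [pt tB] := bF _ t Fp.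
  have [] := psd_entry_le i j pt tB; rewrite !mxE !ler_norml !in_itv /=.
  by case: b.
have [|p /set_mem Fp pmin] := compact_EVT_min _ cpt (continuous_subspaceT (fam_continuousE cf)).
  by exists (to_coords X0); rewrite /= to_coordsK.
exists (of_coords p) => // Y FY.
by have := pmin (to_coords Y); rewrite to_coordsK; apply; apply/mem_set; rewrite /= to_coordsK.
Qed.

End Families.

(** * Schur complements and the terms of the Lehner formula *)

Section Schur.
Context {R : realType}.
Local Notation C := R[i].

Lemma psd_ulsub m n (X : 'M[C]_(m + n)) : psdmx X -> psdmx (ulsubmx X).
Proof.
move=> /(psd_congr (col_mx 1%:M 0)); rewrite -{1}[X]submxK.
rewrite tr_col_mx map_row_mx trmxC_1 trmxC_0 mul_row_block mul_row_col.
by rewrite !(mul1mx, mul0mx, mulmx1, mulmx0, addr0).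
Qed.

Lemma psd_drsub m n (X : 'M[C]_(m + n)) : psdmx X -> psdmx (drsubmx X).
Proof.
move=> /(psd_congr (col_mx 0 1%:M)); rewrite -{1}[X]submxK.
rewrite tr_col_mx map_row_mx trmxC_1 trmxC_0 mul_row_block mul_row_col.
by rewrite !(mul1mx, mul0mx, mulmx1, mulmx0, add0r).
Qed.

Lemma psd_block_diag m n (X : 'M[C]_m) (Y : 'M[C]_n) :
  psdmx X -> psdmx Y -> psdmx (block_mx X 0 0 Y).
Proof.
move=> pX pY; have := psdD (psd_congr (row_mx 1%:M (0 : 'M_(m, n))) pX)
  (psd_congr (row_mx (0 : 'M_(n, m)) 1%:M) pY).
rewrite !tr_row_mx !map_col_mx !trmxC_1 !trmxC_0.
rewrite mul_col_mx mul_col_row mul_col_mx mul_col_row.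
rewrite !(mul1mx, mul0mx, mulmx1, mulmx0) add_block_mx.
by rewrite !(addr0, add0r).
Qed.

(** The block is K^* H K for K = (H^-1 A, 1). *)
Lemma schur_psd m (A H : 'M[C]_m) : A \is hermsymmx -> psdmx H -> H \in unitmx ->
  psdmx (block_mx (A *m invmx H *m A) A A H).
Proof.
move=> /hermP hA pH uH; have hH := herm_trmxC (herm_unit_inv uH (psd_herm pH)).
have := psd_congr (row_mx (invmx H *m A) 1%:M) pH.
rewrite tr_row_mx map_col_mx trmxC_1 trmxC_M hA hH mul_col_mx mul_col_row.
by rewrite !mul1mx !mulmx1 (mulmxKV uH) (mulKVmx uH) mulmxA.
Qed.

(** Restrict the block to the vectors (u, - H^-1 A u). *)
Lemma schur_complement_psd m (A Y H : 'M[C]_m) :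
  A \is hermsymmx -> H \is hermsymmx -> H \in unitmx ->
  psdmx (block_mx Y A A H) -> psdmx (Y - A *m invmx H *m A).
Proof.
move=> /hermP hA hH uH; have hV := herm_trmxC (herm_unit_inv uH hH).
move=> /(psd_congr (col_mx 1%:M (- (invmx H *m A)))).
rewrite tr_col_mx map_row_mx trmxC_1 trmxC_N trmxC_M hA hV.
rewrite mul_row_block mul_row_col !mul1mx !mulNmx (mulmxKV uH) subrr mul0mx addr0.
by rewrite mulmx1.
Qed.

End Schur.

Section Lehner.
Context {R : realType} {d : nat}.
Local Notation C := R[i].
Implicit Types Z Y A B V : 'M[C]_d.

Lemma sqrtmx_unit Z : pdmx Z -> sqrtmx Z \in unitmx.
Proof.
move=> pZ; have [_ QQ] := sqrtmxP (pd_psd pZ).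
by have := pd_unit pZ; rewrite -{1}QQ unitmx_mul => /andP[].
Qed.

(** Since (1 + 2 V)^2 = 1 + 4 (V^2 + V) = 1 + 4 B^2, the square root in the definition is
    1 + 2 V. *)
Lemma lehner_termE Z A V : psdmx V ->
  let B := invmx (sqrtmx Z) *m A *m invmx (sqrtmx Z) in
  V *m V + V = B *m B ->
  lehner_term Z A = sqrtmx Z *m V *m sqrtmx Z.
Proof.
move=> pV B VB; rewrite /lehner_term -/B.
have -> : sqrtmx (1%:M + 4 *: (B *m B)) = 1%:M + 2 *: V.
  apply: sqrtmx_eq.
    by apply: psdD; [exact: psd1 | rewrite scaler_nat mulr2n; exact: psdD].
  rewrite -VB mulmxDl !mulmxDr !mul1mx mulmx1 -scalemxAl -scalemxAr scalerA.
  rewrite -natrM -addrA; congr (_ + _); rewrite addrA -scalerDl -natrD addrC.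
  by rewrite -scalerDr.
by rewrite addrAC subrr add0r -scalemxAr -scalemxAl scalerA mulVf ?scale1r ?pnatr_eq0.
Qed.

(** With P = V + 1 and X = P^-1 B the hypothesis reads V = B X = P X^2, so
    that X^2 = 1 - P^-1. Hence X commutes with P, and
    B^2 = P X P X = P (P X^2) = (V + 1) V. *)
Lemma quadratic_fixpoint B V : V + 1%:M \in unitmx ->
  V = B *m invmx (V + 1%:M) *m B -> V *m V + V = B *m B.
Proof.
have -> : V *m V + V = (V + 1%:M) *m V by rewrite mulmxDl mul1mx.
have : V = (V + 1%:M) - 1%:M by rewrite addrK.
move: (V + 1%:M) => P VP uP VE.
have [X XE] : exists X, X = invmx P *m B by eexists.
have PX : P *m X = B by rewrite XE (mulKVmx uP).
have VX : V = B *m X by rewrite {1}VE XE mulmxA.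
have XX : X *m X = 1%:M - invmx P.
  by rewrite {1}XE -mulmxA -VX VP mulmxBr (mulVmx uP) mulmx1.
have XPi : X *m invmx P = invmx P *m X.
  have : X *m (X *m X) = (X *m X) *m X by exact: mulmxA.
  by rewrite XX mulmxBr mulmxBl mulmx1 mul1mx => /addrI/oppr_inj.
have XP : X *m P = P *m X.
  by rewrite -[LHS](mulKVmx uP) (mulmxA (invmx P)) -XPi (mulmxKV uP).
have XB : X *m B = V.
  by have := congr1 (mulmx^~ X) XP; rewrite -mulmxA PX -VX.
by rewrite -[in RHS]PX -(mulmxA P) PX XB.
Qed.

(** V is the function x |-> ((1 + 4 x^2)^(1/2) - 1) / 2 of B. *)
Lemma quadratic_root B : B \is hermsymmx ->
  exists V, [/\ psdmx V, V *m B = B *m V & V *m V + V = B *m B].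
Proof.
move=> hB; have [U [e [UU UU' BE]]] := herm_spectral hB.
have [f fE] : exists f : 'rV[R]_d, f = \row_j ((Num.sqrt (1 + 4 * e 0 j ^+ 2) - 1) / 2).
  by eexists.
exists (U ^t* *m real_diag f *m U); rewrite BE; split.
- apply/psd_congr/psd_real_diag => j; rewrite fE mxE divr_ge0 // subr_ge0.
  by rewrite -[leLHS]sqrtr1 ler_wsqrtr // lerDl mulr_ge0 // sqr_ge0.
- rewrite (unitary_congrM f e UU) (unitary_congrM e f UU).
  suff -> : \row_j (f 0 j * e 0 j) = \row_j (e 0 j * f 0 j) by [].
  by apply/rowP => j; rewrite [LHS]mxE [RHS]mxE mulrC.
rewrite (unitary_congrM f f UU) (unitary_congrM e e UU) -mulmxDl -mulmxDr -real_diagD.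
suff -> : \row_j (f 0 j * f 0 j) + f = \row_j (e 0 j * e 0 j) by [].
apply/rowP => j; rewrite fE !mxE.
have : Num.sqrt (1 + 4 * e 0 j ^+ 2) ^+ 2 = 1 + 4 * e 0 j ^+ 2.
  by rewrite sqr_sqrtr // addr_ge0 // mulr_ge0 // sqr_ge0.
move: (Num.sqrt _) => s; rewrite !expr2 => hs; lra.
Qed.

Lemma unit_psdD1 V : psdmx V -> V + 1%:M \in unitmx.
Proof.
move=> pV; apply: pd_unit; rewrite addrC.
by apply: (pdD_psd _ pV); exact: (pd_scalar d ltr01).
Qed.

(** The Schur complement V - B (V + 1)^-1 B vanishes, because B commutes with
    V and B^2 = (V + 1) V. *)
Lemma quadratic_root_block B V : B \is hermsymmx -> psdmx V ->
  V *m B = B *m V -> V *m V + V = B *m B -> psdmx (block_mx V B B (V + 1%:M)).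
Proof.
move=> hB pV VB VV; have uP := unit_psdD1 pV.
suff VE : B *m invmx (V + 1%:M) *m B = V.
  by have := schur_psd hB (psdD pV (psd1 d)) uP; rewrite VE.
have PB : (V + 1%:M) *m B = B *m (V + 1%:M).
  by rewrite mulmxDl mulmxDr VB mul1mx mulmx1.
have PV : B *m B = (V + 1%:M) *m V by rewrite -VV mulmxDl mul1mx.
move: (V + 1%:M) uP PB PV => P uP PB PV.
have -> : B *m invmx P = invmx P *m B.
  by rewrite -[LHS](mulKmx uP) (mulmxA _ B) PB (mulmxK uP).
by rewrite -mulmxA PV (mulKmx uP).
Qed.

Lemma psd_block_congr (Q X Y W : 'M[C]_d) : Q ^t* = Q ->
  psdmx (block_mx X Y Y W) ->
  psdmx (block_mx (Q *m X *m Q) (Q *m Y *m Q) (Q *m Y *m Q) (Q *m W *m Q)).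
Proof.
move=> hQ /(psd_congr (block_mx Q 0 0 Q)).
rewrite trmxC_block hQ trmxC_0 !mulmx_block !mulmx0 !mul0mx.
by rewrite !addr0 !add0r.
Qed.

(** Conjugation by Z^(-1/2) turns the equation into that of
    quadratic_fixpoint. *)
Lemma lehner_term_fixpoint Z A Y : pdmx Z -> psdmx Y ->
  Y = A *m invmx (Y + Z) *m A -> lehner_term Z A = Y.
Proof.
move=> pZ pY YE.
have := @lehner_termE Z A; have := sqrtmx_unit pZ; have := sqrtmxP (pd_psd pZ).
move: (sqrtmx Z) => Q [pQ QQ] uQ /=.
have hQi := herm_trmxC (herm_unit_inv uQ (psd_herm pQ)).
have [V VE] : exists V, V = invmx Q *m Y *m invmx Q by eexists.
have YV : Q *m V *m Q = Y.
  by rewrite VE !mulmxA (mulmxV uQ) mul1mx (mulmxKV uQ).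
have pV : psdmx V by have := psd_congr (invmx Q) pY; rewrite hQi -VE.
have uP := unit_psdD1 pV.
move=> /(_ V pV); rewrite YV; apply; apply: (quadratic_fixpoint uP).
have HE : Y + Z = Q *m (V + 1%:M) *m Q.
  by rewrite mulmxDr mulmxDl mulmx1 QQ YV.
move: (V + 1%:M) uP HE => P uP HE.
have HiE : invmx (Y + Z) = invmx Q *m invmx P *m invmx Q.
  have uH : Q *m P *m Q \in unitmx by rewrite !unitmx_mul uQ uP.
  rewrite HE -[LHS]mul1mx; apply: (canLR (mulmxK uH)).
  rewrite -!mulmxA (mulKmx uQ) (mulKmx uP).
  by rewrite (mulVmx uQ).
by rewrite {1}VE {1}YE HiE -!mulmxA.
Qed.

Lemma lehner_term_feasible Z A : pdmx Z -> A \is hermsymmx ->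
  psdmx (block_mx (lehner_term Z A) A A (lehner_term Z A + Z)).
Proof.
move=> pZ hA.
have := @lehner_termE Z A; have := sqrtmx_unit pZ; have := sqrtmxP (pd_psd pZ).
move: (sqrtmx Z) => Q [pQ QQ] uQ /= LE.
have hQ := herm_trmxC (psd_herm pQ).
have hQi := herm_trmxC (herm_unit_inv uQ (psd_herm pQ)).
have := herm_congr (invmx Q) hA; rewrite hQi => hB.
have [V [pV VB VV]] := quadratic_root hB; rewrite (LE V pV VV).
have := psd_block_congr hQ (quadratic_root_block hB pV VB VV).
by rewrite mulmxDr mulmxDl mulmx1 QQ !mulmxA (mulmxV uQ) mul1mx (mulmxKV uQ).
Qed.

End Lehner.

(** * Lagrangian duality *)

Section Rays.
Context {R : realType}.
Implicit Types (E : set \bar R) (a b : R).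

(** The dual functions take infinite values because the Lagrangians are affine
    on rays of their domains. *)
Lemma ereal_inf_ray E a b : b < 0 ->
  (forall s : R, 0 <= s -> E (a + s * b)%:E) -> ereal_inf E = -oo%E.
Proof.
move=> b0 Eray; have lbE s : 0 <= s -> (ereal_inf E <= (a + s * b)%:E)%E.
  by move=> /Eray; exact: ereal_inf_lbound.
case: (ereal_inf E) lbE => [r| |] // lbE; last by have := lbE 0 (lexx _).
pose s := Num.max 0 ((r - a - 1) / b).
have := lbE s; rewrite le_max lexx lee_fin => /(_ isT) rs.
have : s * b <= r - a - 1.
  by rewrite -ler_ndivrMr // le_max lexx orbT.
by move=> sb; exfalso; lra.
Qed.

Lemma ereal_sup_ray E a b : 0 < b ->
  (forall s : R, 0 <= s -> E (a + s * b)%:E) -> ereal_sup E = +oo%E.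
Proof.
move=> b0 Eray; have ubE s : 0 <= s -> ((a + s * b)%:E <= ereal_sup E)%E.
  by move=> /Eray; exact: ereal_sup_ubound.
case: (ereal_sup E) ubE => [r| |] // ubE; last by have := ubE 0 (lexx _).
pose s := Num.max 0 ((r - a + 1) / b).
have := ubE s; rewrite le_max lexx lee_fin => /(_ isT) rs.
have : r - a + 1 <= s * b.
  by rewrite -ler_pdivrMr // le_max lexx orbT.
by move=> sb; exfalso; lra.
Qed.

Lemma ereal_inf_image_min (T : Type) (D : set T) (f : T -> R) t :
  D t -> (forall u, D u -> f t <= f u) ->
  ereal_inf [set (f u)%:E | u in D] = (f t)%:E.
Proof.
move=> Dt ft; apply/eqP; rewrite eq_le; apply/andP; split.
  by apply: ereal_inf_lbound; exists t.
by apply: le_ereal_inf_tmp => _ [u Du <-]; rewrite lee_fin ft.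
Qed.

Lemma ereal_sup_image_max (T : Type) (D : set T) (f : T -> R) t :
  D t -> (forall u, D u -> f u <= f t) ->
  ereal_sup [set (f u)%:E | u in D] = (f t)%:E.
Proof.
move=> Dt ft; apply/eqP; rewrite eq_le; apply/andP; split.
  by apply: ge_ereal_sup => _ [u Du <-]; rewrite lee_fin ft.
by apply: ereal_sup_ubound; exists t.
Qed.

End Rays.

Section Lagrangian.
Context {R : realType} {d n : nat}.
Local Notation C := R[i].
Variables (A0 : 'M[C]_d) (A : 'I_n -> 'M[C]_d).
Implicit Types (x : primal_var R d n) (y : dual_var R d n).

Lemma mxdot_dual_primal_block x y i :
  mxdot (dual_block y i) (primal_block A x i) =
  mxdot (pY x i) (dS y i + dT y i) + mxdot (pZ x) (dT y i)
  - mxdot (A i) (dR y i + (dR y i) ^t*).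
Proof.
rewrite mxdot_block !mxdotNl !mxdotDr (mxdotC (dR y i)) (mxdotC (_ ^t*)).
rewrite (mxdotC (dS y i)) (mxdotC (dT y i) (pY x i)) (mxdotC (dT y i) (pZ x)).
move: (mxdot (A i) (dR y i)) (mxdot (A i) _) => r r'.
move: (mxdot (pY x i) _) (mxdot (pY x i) _) (mxdot (pZ x) _) => s t z.
ring.
Qed.

(** Collect the terms of the first Lagrangian by primal variables instead of by
    multipliers. *)
Lemma lagrangian_sym x y :
  primal_lagrangian A0 A x y = dual_lagrangian A0 A y x.
Proof.
rewrite /primal_lagrangian /dual_lagrangian /dual_objective.
under eq_bigr do rewrite mxdot_dual_primal_block.
rewrite /primal_slack /dual_slack !mxdotBr (mxdotC _ (_%:M)) mxdot_scalar.
rewrite !mxdotDr !mxdot_sumr.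
under [X in _ = _ + X + _ + _]eq_bigr do rewrite mxdotBr.
rewrite !sumrB !big_split /= (mxdotC (dDelta y)) (mxdotC (dDelta y)).
have -> : \sum_(i < n) mxdot (dDelta y) (pY x i) =
    \sum_(i < n) mxdot (pY x i) (dDelta y).
  by apply: eq_bigr => i _; exact: mxdotC.
move: (\sum_(i < n) mxdot (A i) _) (\sum_(i < n) mxdot (pY x i) (dDelta y)) => s1 s2.
move: (\sum_(i < n) mxdot (pY x i) _) (\sum_(i < n) mxdot (pZ x) _) => s3 s4.
move: (mxdot (pZ x) _) (mxdot A0 _) (complex.Re _) => s5 s6 s7.
ring.
Qed.

Lemma dual_lagrangianE y x : dual_lagrangian A0 A y x =
  pc x - \sum_(i < n) mxdot (dual_block y i) (primal_block A x i)
       - mxdot (dDelta y) (primal_slack A0 x).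
Proof. by rewrite -lagrangian_sym. Qed.

Lemma dual_feasible_lagrangian y x : dual_feasible y ->
  dual_lagrangian A0 A y x =
  dual_objective A0 A y + mxdot (pZ x) (dual_slack y).
Proof.
move=> [_ hb _ tr1]; rewrite /dual_lagrangian big1 => [|i _].
  by rewrite tr1 subrr mulr0 !addr0.
by have [_ ->] := hb i; rewrite subrr mxdot0r.
Qed.

(** Delta = S_i + T_i for some i, which is where 0 < n enters. *)
Lemma dual_feasible_domain y : (0 < n)%N -> dual_feasible y -> dual_domain y.
Proof.
move=> n0 [hy hb _ _]; split=> // [|i]; last by have [] := hb i.
have [pb <-] := hb (Ordinal n0); apply: psdD.
  by have := psd_ulsub pb; rewrite block_mxKul.
by have := psd_drsub pb; rewrite block_mxKdr.
Qed.

Lemma primal_domain_min_dual_objective y : dual_feasible y ->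
  forall x, primal_domain x -> dual_objective A0 A y <= primal_lagrangian A0 A x y.
Proof.
move=> fy x [_ pZx]; rewrite lagrangian_sym dual_feasible_lagrangian // lerDl.
by have [_ _ ps _] := fy; exact: psd_dot_ge0.
Qed.

Lemma dual_domain_lagrangian_le x y : primal_feasible A0 A x -> dual_domain y ->
  dual_lagrangian A0 A y x <= pc x.
Proof.
move=> [_ _ pb ps] [_ pD db]; rewrite dual_lagrangianE -addrA gerDl -opprD oppr_le0.
by rewrite addr_ge0 ?psd_dot_ge0 // sumr_ge0 // => i _; rewrite psd_dot_ge0.
Qed.

Lemma weak_duality x y : (0 < n)%N ->
  primal_feasible A0 A x -> dual_feasible y -> dual_objective A0 A y <= pc x.
Proof.
move=> n0 fx fy; apply: le_trans (dual_domain_lagrangian_le fx (dual_feasible_domain n0 fy)).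
rewrite -lagrangian_sym; apply: primal_domain_min_dual_objective => //.
by case: fx.
Qed.

(** The infimum is attained at x = 0 if y is feasible. Otherwise the Lagrangian
    decreases to -oo along a ray: with Y proportional to the residuals of the
    matrix equations, Z to v v^* for a v at which the form of the slack is
    negative, or c to 1 - tr Delta. *)
Lemma dual_is_lagrangian_dual : (0 < n)%N -> dual_is_lagrangian_dual_of_primal A0 A.
Proof.
move=> n0; split=> [y|y dy /=]; first exact: dual_feasible_domain.
split=> [fy|nfy].
  pose x0 := PrimalVar 0 (0 : 'M[C]_d) (fun _ : 'I_n => 0).
  have -> : dual_objective A0 A y = primal_lagrangian A0 A x0 y.
    by rewrite lagrangian_sym dual_feasible_lagrangian // mxdot0l addr0.
  apply: ereal_inf_image_min => [|x dx].
    split; last exact: psd0.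
    by split=> [|i]; exact: herm0.
  rewrite [leLHS]lagrangian_sym dual_feasible_lagrangian // mxdot0l addr0.
  exact: primal_domain_min_dual_objective.
have [hy pD pb] := dy; have [hD hST] := hy.
pose res i := dDelta y - (dS y i + dT y i).
have hres i : res i \is hermsymmx.
  by have [hS hT] := hST i; exact: (hermB hD (hermD hS hT)).
have hslack : dual_slack y \is hermsymmx.
  by apply: (hermB hD); apply: herm_sum => i; have [] := hST i.
have [res0|resn0] := eqVneq (\sum_i mxdot (res i) (res i)) 0; last first.
  apply: (@ereal_inf_ray _ _ (dual_objective A0 A y) (- \sum_i mxdot (res i) (res i))).
    rewrite oppr_lt0 lt_neqAle eq_sym resn0 sumr_ge0 // => i _; exact: mxdot_ge0.
  move=> s s0; exists (PrimalVar 0 0 (fun i => (- s)%:C *: res i)).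
    split; last exact: psd0.
    by split=> [|i]; [exact: herm0 | exact: (hermZ (- s) (hres i))].
  rewrite lagrangian_sym /dual_lagrangian /= mxdot0l mul0r !addr0; congr (_ + _)%:E.
  rewrite mulrN -mulNr mulr_sumr; apply: eq_bigr => i _.
  by rewrite mxdotZl.
have {res0}res0 i : dS y i + dT y i = dDelta y.
  move/eqP: res0; rewrite psumr_eq0 => [|j _]; last exact: mxdot_ge0.
  by move=> /allP/(_ i (mem_index_enum _))/eqP/mxdot_eq0/eqP; rewrite subr_eq0 => /eqP.
have LE x : primal_lagrangian A0 A x y = dual_objective A0 A y
    + mxdot (pZ x) (dual_slack y) + pc x * (1 - complex.Re (\tr (dDelta y))).
  rewrite lagrangian_sym /dual_lagrangian big1 ?addr0 // => i _.
  by rewrite res0 subrr mxdot0r.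
have [ps|nps] := pselect (psdmx (dual_slack y)); last first.
  have [v vneg] := not_psd hslack nps.
  apply: (@ereal_inf_ray _ _ (dual_objective A0 A y) _ vneg) => s s0.
  exists (PrimalVar 0 (s%:C *: (v *m v ^t*)) (fun=> 0)).
    split; last exact: (psdZ s0 (psd_rank1 v)).
    by split=> [|i]; [exact: (hermZ s (psd_herm (psd_rank1 v))) | exact: herm0].
  by rewrite LE /= mul0r addr0 mxdotZl.
set t := 1 - complex.Re (\tr (dDelta y)) in LE.
have t0 : t != 0.
  apply/eqP => t0; apply: nfy; split=> //.
  by rewrite herm_tr // -[complex.Re _](subKr 1) -/t t0 subr0.
apply: (@ereal_inf_ray _ _ (dual_objective A0 A y) (- t ^+ 2)).
  by rewrite oppr_lt0 lt_neqAle eq_sym sqrf_eq0 t0 sqr_ge0.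
move=> s s0; exists (PrimalVar (- s * t) 0 (fun=> 0)).
  split; last exact: psd0.
  by split=> [|i]; exact: herm0.
by rewrite LE /= mxdot0l addr0; congr (_ + _)%:E; ring.
Qed.

Definition dual_of_blocks (Delta : 'M[C]_d) (G : 'I_n -> 'M[C]_(d + d)) :=
  DualVar Delta (fun i => ulsubmx (G i)) (fun i => drsubmx (G i))
    (fun i => - ursubmx (G i)).

Lemma dual_of_blocksK Delta G i : G i \is hermsymmx ->
  dual_block (dual_of_blocks Delta G) i = G i.
Proof.
move=> /hermP hG; rewrite /dual_block /= trmxC_N !opprK.
rewrite -[RHS]submxK; congr block_mx.
have := hG; rewrite -{1 2}[G i]submxK trmxC_block => /eq_block_mx[_ _ + _].
exact.
Qed.

Lemma herm_ulsub (G : 'M[C]_(d + d)) : G \is hermsymmx -> ulsubmx G \is hermsymmx.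
Proof.
move=> /hermP hG; apply/hermP.
by have := hG; rewrite -{1 2}[G]submxK trmxC_block => /eq_block_mx[].
Qed.

Lemma herm_drsub (G : 'M[C]_(d + d)) : G \is hermsymmx -> drsubmx G \is hermsymmx.
Proof.
move=> /hermP hG; apply/hermP.
by have := hG; rewrite -{1 2}[G]submxK trmxC_block => /eq_block_mx[].
Qed.

Lemma dual_of_blocks_domain Delta G : psdmx Delta -> (forall i, psdmx (G i)) ->
  dual_domain (dual_of_blocks Delta G).
Proof.
move=> pD pG; have hG i := psd_herm (pG i).
split=> [|//|i]; last by rewrite dual_of_blocksK.
by split=> [|i]; [exact: psd_herm | split; [exact: herm_ulsub | exact: herm_drsub]].
Qed.

(** The supremum is attained at y = 0 if x is feasible. Otherwise some block or
    the slack has a negative value at a vector v, and v v^* as its multiplier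
    spans a ray on which the Lagrangian increases to +oo. *)
Lemma primal_is_lagrangian_dual : A0 \is hermsymmx ->
  (forall i, A i \is hermsymmx) -> primal_is_lagrangian_dual_of_dual A0 A.
Proof.
move=> hA0 hA; split=> [x [? ?]//|x dx /=].
have [[hZ hY] pZx] := dx.
have LE Delta G : (forall i, G i \is hermsymmx) ->
    dual_lagrangian A0 A (dual_of_blocks Delta G) x =
    pc x - \sum_(i < n) mxdot (G i) (primal_block A x i)
         - mxdot Delta (primal_slack A0 x).
  move=> hG; rewrite dual_lagrangianE.
  by under eq_bigr do rewrite dual_of_blocksK //.
split=> [fx|nfx].
  pose y0 := dual_of_blocks 0 (fun=> 0).
  have Ly0 : dual_lagrangian A0 A y0 x = pc x.
    rewrite LE => [|i]; last exact: herm0.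
    by rewrite big1 => [|i _]; rewrite mxdot0l ?subr0.
  rewrite -[in RHS]Ly0; apply: ereal_sup_image_max => [|y dy].
    by apply: dual_of_blocks_domain => [|i]; exact: psd0.
  by rewrite Ly0; exact: dual_domain_lagrangian_le.
have hblock i : primal_block A x i \is hermsymmx.
  rewrite /primal_block -{2}(herm_trmxC (hA i)).
  exact: (herm_block _ (hY i) (hermD (hY i) hZ)).
have hslack : primal_slack A0 x \is hermsymmx.
  exact: (hermB (herm_scalar _ _) (hermD (hermD hZ hA0) (herm_sum hY))).
have [ps|nps] := pselect (psdmx (primal_slack A0 x)); last first.
  have [v vneg] := not_psd hslack nps.
  apply: (@ereal_sup_ray _ _ (pc x) (- mxdot (v *m v ^t*) (primal_slack A0 x))).
    by rewrite oppr_gt0.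
  move=> s s0; exists (dual_of_blocks (s%:C *: (v *m v ^t*)) (fun=> 0)).
    by apply: dual_of_blocks_domain => [|i]; [exact: (psdZ s0 (psd_rank1 v)) | exact: psd0].
  rewrite LE => [|i]; last exact: herm0.
  rewrite big1 => [|i _]; last exact: mxdot0l.
  by rewrite subr0 mxdotZl mulrN.
have [i npi] : exists i, ~ psdmx (primal_block A x i).
  by apply/existsNP => pb; apply: nfx.
have [v vneg] := not_psd (hblock i) npi.
apply: (@ereal_sup_ray _ _ (pc x) (- mxdot (v *m v ^t*) (primal_block A x i))).
  by rewrite oppr_gt0.
move=> s s0; pose G j := if j == i then s%:C *: (v *m v ^t*) else 0.
have pG j : psdmx (G j).
  rewrite /G; case: ifP => _; last exact: psd0.
  exact: (psdZ s0 (psd_rank1 v)).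
exists (dual_of_blocks 0 G); first exact: (dual_of_blocks_domain (psd0 _) pG).
rewrite LE => [|j]; last exact: psd_herm.
rewrite mxdot0l subr0 (bigD1 i) //= big1 => [|j /negbTE ji].
  by rewrite addr0 /G eqxx mxdotZl mulrN.
by rewrite /G ji mxdot0l.
Qed.

End Lagrangian.

(** * The minimization program and the Lehner formula *)

Section Rearrangements.
Context {K : comNzRingType} {d : nat}.
Implicit Types a c e s w y z : 'M[K]_d.

Lemma lower_Y_raise_Z y (y' : 'M[K]_d) z w s :
  y' + (z + (w + ((y - y') + s))) = (y + z) + (w + s).
Proof. by apply/matrixP => i j; rewrite !mxE; ring. Qed.

Lemma gain_uses_slack c z a s (s' : 'M[K]_d) :
  c - (z + (c - (z + a + s) + (s - s')) + a + s') = 0.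
Proof. by apply/matrixP => i j; rewrite !mxE; ring. Qed.

Lemma shift_both c e z a s : c + e - (z + e + a + s) = c - (z + a + s).
Proof. by apply/matrixP => i j; rewrite !mxE; ring. Qed.

End Rearrangements.

Section PrimalAttainment.
Context {R : realType} {d n : nat}.
Local Notation C := R[i].
Variables (A0 : 'M[C]_d) (A : 'I_n -> 'M[C]_d).
Hypotheses (d_gt0 : (0 < d)%N) (A0_herm : A0 \is hermsymmx).
Hypothesis A_herm : forall i, A i \is hermsymmx.
Implicit Types x : primal_var R d n.

Lemma primal_feasibleI x : psdmx (pZ x) ->
  (forall i, psdmx (primal_block A x i)) -> psdmx (primal_slack A0 x) ->
  primal_feasible A0 A x.
Proof.
move=> pZx pB pS; split; [split=> [|i] | exact: pZx | exact: pB | exact: pS].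
  exact: psd_herm pZx.
by apply: psd_herm; have := psd_ulsub (pB i); rewrite block_mxKul.
Qed.

Lemma primal_feasible_Y x i : primal_feasible A0 A x -> psdmx (pY x i).
Proof. by move=> [_ _ /(_ i)/psd_ulsub + _]; rewrite block_mxKul. Qed.

Local Notation family := (option (option 'I_n) -> 'M[C]_d).

Definition family_total (X : family) : 'M[C]_d :=
  X (Some None) + A0 + \sum_i X (Some (Some i)) + X None.

(** The slack matrix X None is kept as a variable, so that c can be recovered
    from the trace of the identity Z + A0 + sum_i Y_i + X None = c I. *)
Definition primal_of_family (X : family) : primal_var R d n :=
  PrimalVar (complex.Re (\tr (family_total X)) / d%:R)
    (X (Some None)) (fun i => X (Some (Some i))).

Definition family_of_primal x : family := fun t =>
  match t with
  | None => primal_slack A0 x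
  | Some None => pZ x
  | Some (Some i) => pY x i
  end.

Lemma family_of_primalK x : primal_of_family (family_of_primal x) = x.
Proof.
case: x => c Z Y; rewrite /primal_of_family; congr PrimalVar.
rewrite /family_total /= /primal_slack /= addrC subrK mxtrace_scalar.
have -> : complex.Re (c%:C *+ d) = c * d%:R.
  by elim: d => [|k IH]; rewrite ?mulr0 // mulrS ReD IH mulrSr mulrDr mulr1 addrC.
by rewrite mulfK // pnatr_eq0 -lt0n.
Qed.

Lemma family_total_continuous : fam_mx_continuous family_total.
Proof.
apply: fam_mx_continuousD; last exact: fam_mx_continuous_proj.
apply: fam_mx_continuousD; first apply: fam_mx_continuousD.
- exact: fam_mx_continuous_proj.
- exact: fam_mx_continuous_cst.
by apply: fam_mx_continuous_sum => i; exact: fam_mx_continuous_proj.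
Qed.

Lemma pc_continuous : fam_continuous (fun X => pc (primal_of_family X)).
Proof.
apply: fam_continuousM; last exact: fam_continuous_cst.
exact/fam_continuous_Re_tr/family_total_continuous.
Qed.

Definition feasible_families (c0 : R) : set family :=
  [set X | [/\ psdmx (X (Some None)),
     forall i, psdmx (primal_block A (primal_of_family X) i),
     psdmx (X None), X None = primal_slack A0 (primal_of_family X)
     & pc (primal_of_family X) <= c0]].

Lemma feasible_families_closed c0 : fam_closed (feasible_families c0).
Proof.
have cproj t : fam_mx_continuous (fun X : family => X t) := fam_mx_continuous_proj t.
have cblock i : fam_mx_continuous (fun X => primal_block A (primal_of_family X) i).
  exact: (fam_mx_continuous_block _ _ (cproj (Some (Some i)))
    (fam_mx_continuousD (cproj (Some (Some i))) (cproj (Some None)))).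
have cslack : fam_mx_continuous (fun X => primal_slack A0 (primal_of_family X)).
  apply: fam_mx_continuousB; first exact: (fam_mx_continuous_scalar _ pc_continuous).
  exact: (fam_mx_continuousD
    (fam_mx_continuousD (cproj (Some None)) (fam_mx_continuous_cst _))
    (fam_mx_continuous_sum _ (fun i => cproj (Some (Some i))))).
have := fam_closedI (fam_closed_psd (cproj (Some None)))
  (fam_closedI (fam_closed_forall (fun i => fam_closed_psd (cblock i)))
  (fam_closedI (fam_closed_psd (cproj None))
  (fam_closedI (fam_closed_mx_eq (cproj None) cslack)
               (fam_closed_le pc_continuous (@fam_continuous_cst _ _ _ c0))))).
congr fam_closed; apply/seteqP; split=> X /=.
  by move=> [? [? [? [? ?]]]].
by move=> [].
Qed.

(** The trace of family_total is c d, and all its summands except A0 have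
    nonnegative traces. *)
Lemma feasible_families_bounded c0 X t : feasible_families c0 X ->
  psdmx (X t) /\ complex.Re (\tr (X t)) <= c0 * d%:R - complex.Re (\tr A0).
Proof.
move=> [pZX pB pW WE cX].
have pY i : psdmx (X (Some (Some i))) by have := psd_ulsub (pB i); rewrite block_mxKul.
have pX s : psdmx (X s) by case: s => [[]|].
split; first exact: pX.
have [r rE] : exists r, forall s, complex.Re (\tr (X s)) = r s by eexists.
have r0 s : 0 <= r s by rewrite -rE; exact: psd_tr_ge0 (pX s).
have le : r (Some None) + complex.Re (\tr A0)
    + \sum_i r (Some (Some i)) + r None <= c0 * d%:R.
  move: cX; rewrite /= ler_pdivrMr ?ltr0n // /family_total !mxtraceD !ReD !rE.
  rewrite Re_tr_sum.
  by rewrite (eq_bigr _ (fun i _ => rE (Some (Some i)))).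
have sum0 : 0 <= \sum_i r (Some (Some i)) by apply: sumr_ge0.
have hZ := r0 (Some None); have hW := r0 None; rewrite rE.
case: t => [[i|]|]; [|lra|lra].
have : r (Some (Some i)) <= \sum_i r (Some (Some i)).
  by rewrite (bigD1 i) //= lerDl sumr_ge0.
lra.
Qed.

Lemma family_of_primal_feasible c0 x : primal_feasible A0 A x -> pc x <= c0 ->
  feasible_families c0 (family_of_primal x).
Proof.
move=> [_ pZx pB pS] cx; split; rewrite ?family_of_primalK.
- exact: pZx.
- exact: pB.
- exact: pS.
- by [].
- exact: cx.
Qed.

(** On a sublevel set of c the matrices Z, Y_i and the slack are positive
    semidefinite with bounded total trace: the extreme value theorem applies. *)
Lemma primal_min (D : set (primal_var R d n)) (f : primal_var R d n -> R) c0 x0 :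
  fam_closed (primal_of_family @^-1` D) ->
  fam_continuous (f \o primal_of_family) ->
  primal_feasible A0 A x0 -> pc x0 <= c0 -> D x0 ->
  exists x, [/\ primal_feasible A0 A x, D x &
    forall y, primal_feasible A0 A y -> pc y <= c0 -> D y -> f x <= f y].
Proof.
move=> cD cf fx0 cx0 Dx0.
have [||X t []|X [[pZX pB pW WE _]] DX Xmin] := @psd_family_min R d _
  (feasible_families c0 `&` primal_of_family @^-1` D)
  (c0 * d%:R - complex.Re (\tr A0)) (f \o primal_of_family) _ _ _ cf.
- exists (family_of_primal x0); split; first exact: family_of_primal_feasible.
  by rewrite /= family_of_primalK.
- exact: (fam_closedI (feasible_families_closed c0) cD).
- by move=> /feasible_families_bounded.
rewrite WE in pW.
exists (primal_of_family X); split; [exact: (@primal_feasibleI (primal_of_family X) pZX pB pW) | exact: DX |].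
move=> y fy cy Dy.
have := Xmin (family_of_primal y); rewrite /= family_of_primalK; apply.
by split; [exact: family_of_primal_feasible | exact: Dy].
Qed.

Lemma primal_attained x0 : primal_feasible A0 A x0 ->
  exists2 x, primal_feasible A0 A x & forall y, primal_feasible A0 A y -> pc x <= pc y.
Proof.
move=> fx0.
have [x [fx _ xmin]] := @primal_min setT (@pc R d n) (pc x0) x0
  fam_closedT pc_continuous fx0 (lexx _) I.
exists x => // y fy; have [yx0|/ltW x0y] := leP (pc y) (pc x0); first exact: xmin.
by apply: le_trans x0y; exact: xmin.
Qed.

Lemma lehner_primal_feasible Z : pdmx Z ->
  primal_feasible A0 A (PrimalVar
    (lambda_max (Z + A0 + \sum_i lehner_term Z (A i))) Z
    (fun i => lehner_term Z (A i))).
Proof.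
move=> pZ.
apply: primal_feasibleI => [|i|]; first exact: pd_psd.
  exact: lehner_term_feasible.
have hL i : lehner_term Z (A i) \is hermsymmx.
  have := psd_ulsub (lehner_term_feasible pZ (A_herm i)).
  by rewrite block_mxKul => /psd_herm.
apply: (proj1 (lambda_maxP d_gt0 _)).
exact: (hermD (hermD (psd_herm (pd_psd pZ)) A0_herm) (herm_sum hL)).
Qed.

(** Among the feasible points with the same c and a Z at least as large, one of
    maximal trace of Z has Y_i = A_i (Y_i + Z)^-1 A_i for every i. Otherwise each Y_i
    could be lowered to this value, and Z raised by the total amount gained. *)
Lemma lehner_le_feasible x : primal_feasible A0 A x -> pdmx (pZ x) ->
  exists2 Z, pdmx Z & lambda_max (Z + A0 + \sum_i lehner_term Z (A i)) <= pc x.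
Proof.
move=> fx pZx.
pose D : set (primal_var R d n) := [set y | pc y = pc x /\ psdmx (pZ y - pZ x)].
pose f (y : primal_var R d n) := - complex.Re (\tr (pZ y)).
have cZ : fam_mx_continuous (fun X => pZ (primal_of_family X)).
  exact: fam_mx_continuous_proj.
have [|||y [fy [cy pZy] ymin]] := @primal_min D f (pc x) x _ _ fx (lexx _) _.
- have := fam_closedI (fam_closed_eq pc_continuous (@fam_continuous_cst _ _ _ (pc x)))
    (fam_closed_psd (fam_mx_continuousB cZ (@fam_mx_continuous_cst _ _ _ _ (pZ x)))).
  by [].
- exact/fam_continuousN/fam_continuous_Re_tr.
- by split; [| rewrite subrr; exact: psd0].
have pdZ : pdmx (pZ y) by rewrite -(subrKC (pZ x) (pZ y)); exact: (pdD_psd pZx pZy).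
have [_ _ pB pS] := fy.
pose H i := pY y i + pZ y.
have pH i : pdmx (H i).
  by rewrite /H addrC; exact: (pdD_psd pdZ (primal_feasible_Y i fy)).
have uH i : H i \in unitmx := pd_unit (pH i).
pose Y' i := A i *m invmx (H i) *m A i.
pose E i := pY y i - Y' i.
have pE i : psdmx (E i).
  exact: (schur_complement_psd (A_herm i) (psd_herm (pd_psd (pH i))) (uH i) (pB i)).
set W := primal_slack A0 y in pS.
(* The slack W is added to Z as well, so that the new slack is 0. *)
pose gain := W + \sum_i E i.
have pgain : psdmx gain by exact: (psdD pS (psd_sum _ pE)).
pose y' := PrimalVar (pc x) (pZ y + gain) Y'.
have fy' : primal_feasible A0 A y'.
  apply: primal_feasibleI => [|i|]; first exact: (psdD (pd_psd pdZ) pgain).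
    have -> : primal_block A y' i = block_mx (Y' i) (A i) (A i) (H i)
        + block_mx 0 0 0 (W + \sum_(j | j != i) E j).
      rewrite add_block_mx !addr0 /primal_block /= /gain (bigD1 i) //=.
      by rewrite lower_Y_raise_Z.
    apply: psdD; first exact: (schur_psd (A_herm i) (pd_psd (pH i)) (uH i)).
    exact: (psd_block_diag (psd0 _) (psdD pS (psd_sum _ pE))).
  suff -> : primal_slack A0 y' = 0 by exact: psd0.
  rewrite /primal_slack /= /gain sumrB /W /primal_slack cy.
  exact: gain_uses_slack.
have gain0 : gain = 0.
  apply: (psd_tr_eq0 pgain); apply/eqP; rewrite eq_le (psd_tr_ge0 pgain) andbT.
  have : f y <= f y'.
    apply: (ymin _ fy' (lexx _)); split; first by [].
    by rewrite /= addrAC; exact: (psdD pZy pgain).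
  rewrite /f /= (mxtraceD (pZ y)) ReD lerN2 gerDl; exact.
have E0 i : E i = 0.
  apply: (psd_tr_eq0 (pE i)); apply/eqP; rewrite eq_le (psd_tr_ge0 (pE i)) andbT.
  have /(congr1 (fun M => complex.Re (\tr M))) := gain0.
  rewrite /gain (bigD1 i) //= (mxtraceD W) (mxtraceD (E i)) !ReD mxtrace0 raddf0.
  have := psd_tr_ge0 pS.
  have := psd_tr_ge0 (psd_sum (fun j => j != i) pE).
  move: (complex.Re _) (complex.Re _) (complex.Re _) => a b c; lra.
exists (pZ y) => //.
have -> : \sum_i lehner_term (pZ y) (A i) = \sum_i pY y i.
  apply: eq_bigr => i _.
  apply: (lehner_term_fixpoint pdZ (primal_feasible_Y i fy)).
  by apply/eqP; rewrite -subr_eq0; apply/eqP; exact: E0.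
have [[hZ hY] _ _ _] := fy.
have [_ /(_ (pc x))] := lambda_maxP d_gt0 (hermD (hermD hZ A0_herm) (herm_sum hY)).
by apply; rewrite -cy; exact: pS.
Qed.

(** Since Z may be singular, e I is added to Z, and e to c in compensation. *)
Lemma Lambda_rad_le_feasible x : primal_feasible A0 A x ->
  (Lambda_rad A0 A <= (pc x)%:E)%E.
Proof.
move=> [_ pZx pB pS]; apply/lee_addgt0Pr => e e0.
pose x' := PrimalVar (pc x + e) (pZ x + e%:C%:M) (pY x).
have [||Z pZ Zle] := @lehner_le_feasible x'.
- apply: primal_feasibleI => [|i|] /=.
  + exact: (psdD pZx (psd_scalar _ (ltW e0))).
  + have -> : primal_block A x' i = primal_block A x i + block_mx 0 0 0 e%:C%:M.
      by rewrite /primal_block /= add_block_mx !addr0 addrA.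
    exact: (psdD (pB i) (psd_block_diag (psd0 _) (psd_scalar _ (ltW e0)))).
  suff -> : primal_slack A0 x' = primal_slack A0 x by exact: pS.
  by rewrite /primal_slack /= rmorphD raddfD /= shift_both.
- by rewrite /= addrC; exact: (pdD_psd (pd_scalar _ e0) pZx).
apply: le_trans (_ : (lambda_max (Z + A0 + \sum_i lehner_term Z (A i)))%:E <= _)%E.
  by apply: ereal_inf_lbound; exists Z.
by rewrite -EFinD lee_fin.
Qed.

Lemma primal_value_Lambda : primal_value A0 A = Lambda_rad A0 A.
Proof.
apply/eqP; rewrite eq_le; apply/andP; split.
  apply: le_ereal_inf_tmp => _ [Z pZ <-].
  apply: ereal_inf_lbound; exists (PrimalVar
    (lambda_max (Z + A0 + \sum_i lehner_term Z (A i))) Z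
    (fun i => lehner_term Z (A i))); last by [].
  exact: lehner_primal_feasible.
by apply: le_ereal_inf_tmp => _ [x fx <-]; exact: Lambda_rad_le_feasible.
Qed.

Lemma primal_feasible_ex : exists x, primal_feasible A0 A x.
Proof.
by eexists; apply: (@lehner_primal_feasible 1%:M); exact: (pd_scalar d ltr01).
Qed.

End PrimalAttainment.

(** * Strong duality *)

Lemma sum_option (V : nmodType) (T : finType) (F : option T -> V) :
  \sum_j F j = F None + \sum_i F (Some i).
Proof.
rewrite (bigD1 None) //=; congr (_ + _).
rewrite (reindex_omap Some id) => [|[i|]] //=.
by apply: eq_bigl => i; rewrite eqxx.
Qed.

Lemma shift_block (K : comNzRingType) d (y a z m v : 'M[K]_d) :
  block_mx (y - m) a a (y - m + (z - v)) =
  block_mx y a a (y + z) - block_mx m 0 0 m + block_mx 0 0 0 (- v).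
Proof.
rewrite opp_block_mx !add_block_mx !subr0 !addr0; congr block_mx.
by apply/matrixP => i j; rewrite !mxE; ring.
Qed.

Lemma shift_slack (K : comNzRingType) d (c z v a s u w : 'M[K]_d) :
  c - (z - v + a + (s - u)) = c - (z + a + s) - w + (v + w + u).
Proof. by apply/matrixP => i j; rewrite !mxE; ring. Qed.

Section LeastSquares.
Context {R : realType}.
Local Notation C := R[i].

(** Otherwise s = - b / (c - b) would give a negative value. *)
Lemma slope_ge0 (b c : R) : 0 <= c ->
  (forall s, 0 <= s -> s <= 1 -> 0 <= 2 * s * b + s ^+ 2 * c) -> 0 <= b.
Proof.
move=> c0 h; rewrite leNgt; apply/negP => b0.
have k0 : 0 < c - b by lra.
pose s := - b / (c - b).
have s0 : 0 < s by rewrite divr_gt0 // oppr_gt0.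
have sk : s * (c - b) = - b by rewrite divfK // gt_eqF.
have s1 : s <= 1 by rewrite ler_pdivrMr // mul1r; lra.
have := h s (ltW s0) s1.
have -> : 2 * s * b + s ^+ 2 * c = s * (2 * b + s * c) by ring.
rewrite pmulr_rge0 // => h'.
have : s * b <= 0 by rewrite mulr_ge0_le0 // ltW.
nra.
Qed.

(** The hypothesis says that (a, e) has the least norm on the segment from
    (a, e) to (b, f); the norm then does not decrease initially along it. *)
Lemma least_norm_variational m (J : finType) (a b : J -> 'M[C]_m) (e f : R) :
  (forall s, 0 <= s -> s <= 1 ->
    \sum_j mxdot (a j) (a j) + e ^+ 2 <=
    \sum_j mxdot ((1 - s)%:C *: a j + s%:C *: b j)
                 ((1 - s)%:C *: a j + s%:C *: b j) + ((1 - s) * e + s * f) ^+ 2) ->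
  \sum_j mxdot (a j) (a j) + e ^+ 2 <= \sum_j mxdot (a j) (b j) + e * f.
Proof.
move=> h; rewrite -subr_ge0.
pose c := \sum_j mxdot (b j - a j) (b j - a j) + (f - e) ^+ 2.
apply: (@slope_ge0 _ c) => [|s s0 s1].
  by rewrite addr_ge0 ?sqr_ge0 // sumr_ge0 // => j _; exact: mxdot_ge0.
have := h s s0 s1; rewrite -subr_ge0.
have -> : \sum_j mxdot ((1 - s)%:C *: a j + s%:C *: b j)
                       ((1 - s)%:C *: a j + s%:C *: b j) =
    (1 - s) ^+ 2 * (\sum_j mxdot (a j) (a j))
    + 2 * s * (1 - s) * (\sum_j mxdot (a j) (b j))
    + s ^+ 2 * (\sum_j mxdot (b j) (b j)).
  rewrite !mulr_sumr -!big_split /=; apply: eq_bigr => j _.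
  rewrite !mxdotDr !mxdotDl !mxdotZl !mxdotZr (mxdotC (b j) (a j)).
  by move: (mxdot _ _) (mxdot _ _) (mxdot _ _) => u v w; ring.
have -> : c = \sum_j mxdot (b j) (b j) - 2 * (\sum_j mxdot (a j) (b j))
    + \sum_j mxdot (a j) (a j) + (f - e) ^+ 2.
  congr (_ + _); rewrite mulr_sumr -sumrB -big_split /=; apply: eq_bigr => j _.
  rewrite !mxdotBr !mxdotBl (mxdotC (b j) (a j)).
  by move: (mxdot _ _) (mxdot _ _) (mxdot _ _) => u v w; ring.
move: (\sum_j _) (\sum_j _) (\sum_j _) => u v w; congr (0 <= _); ring.
Qed.

Lemma herm_bottom m (X : 'M[C]_m) : (0 < m)%N -> X \is hermsymmx ->
  exists c : R, exists G : 'M[C]_m,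
    [/\ psdmx G, complex.Re (\tr G) = 1, mxdot G X = c & psdmx (X - c%:C%:M)].
Proof.
move=> m0 hX.
have hN : - X \is hermsymmx.
  by apply/hermP; rewrite trmxC_N herm_trmxC.
have [c [v [Xv v1 pc]]] := herm_top m0 hN.
exists (- c), (v *m v ^t*); split; [exact: psd_rank1 | exact: v1 | |].
  by rewrite -[X]opprK mxdotNr (mxdot_eigen Xv v1).
by move: pc; rewrite opprK rmorphN raddfN /= opprK addrC.
Qed.

End LeastSquares.

Section StrongDuality.
Context {R : realType} {d n : nat}.
Local Notation C := R[i].
Variables (A0 : 'M[C]_d) (A : 'I_n -> 'M[C]_d).
Hypotheses (d_gt0 : (0 < d)%N) (n_gt0 : (0 < n)%N).
Hypotheses (A0_herm : A0 \is hermsymmx) (A_herm : forall i, A i \is hermsymmx).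
Local Notation family := (option 'I_n -> 'M[C]_(d + d)).

(** The diagonal blocks of X None are Delta and a candidate for the slack
    Delta - sum_i T_i; X (Some i) is the i-th block. *)
Definition dual_of_family (X : family) : dual_var R d n :=
  dual_of_blocks (ulsubmx (X None)) (fun i => X (Some i)).

Definition residual (X : family) (j : option 'I_n) : 'M[C]_d :=
  match j with
  | None => drsubmx (X None) - dual_slack (dual_of_family X)
  | Some i => ulsubmx (X (Some i)) + drsubmx (X (Some i)) - ulsubmx (X None)
  end.

Definition objective (X : family) : R := dual_objective A0 A (dual_of_family X).

(** Normalizations that hold at every feasible point, imposed beforehand to
    make the set compact. *)
Definition trace_simplex : set family := [set X |
  [/\ forall t, psdmx (X t), complex.Re (\tr (ulsubmx (X None))) = 1,
      complex.Re (\tr (drsubmx (X None))) <= 1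
    & forall i, complex.Re (\tr (X (Some i))) = 1]].

Definition combine (s : R) (X Y : family) : family :=
  fun t => (1 - s)%:C *: X t + s%:C *: Y t.

Lemma ulsub_comb (a b : C) (X Y : 'M[C]_(d + d)) :
  ulsubmx (a *: X + b *: Y) = a *: ulsubmx X + b *: ulsubmx Y.
Proof. by apply/matrixP => i j; rewrite !mxE. Qed.

Lemma drsub_comb (a b : C) (X Y : 'M[C]_(d + d)) :
  drsubmx (a *: X + b *: Y) = a *: drsubmx X + b *: drsubmx Y.
Proof. by apply/matrixP => i j; rewrite !mxE. Qed.

Lemma ursub_comb (a b : C) (X Y : 'M[C]_(d + d)) :
  ursubmx (a *: X + b *: Y) = a *: ursubmx X + b *: ursubmx Y.
Proof. by apply/matrixP => i j; rewrite !mxE. Qed.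

Lemma mxtrace_blocks (X : 'M[C]_(d + d)) :
  \tr X = \tr (ulsubmx X) + \tr (drsubmx X).
Proof. by rewrite -{1}[X]submxK mxtrace_block. Qed.

Lemma residual_combine s X Y j :
  residual (combine s X Y) j = (1 - s)%:C *: residual X j + s%:C *: residual Y j.
Proof.
case: j => [i|] /=; rewrite /combine.
  rewrite !ulsub_comb drsub_comb.
  move: (ulsubmx (X (Some i))) (drsubmx (X (Some i))) (ulsubmx (X None)).
  move: (ulsubmx (Y (Some i))) (drsubmx (Y (Some i))) (ulsubmx (Y None)).
  by move=> x1 x2 x3 y1 y2 y3; apply/matrixP => k l; rewrite !mxE; ring.
rewrite /dual_slack /= !ulsub_comb drsub_comb.
under eq_bigr do rewrite drsub_comb.
rewrite big_split /= -!scaler_sumr.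
move: (ulsubmx (X None)) (drsubmx (X None)) (\sum_(i < n) drsubmx (X _)).
move: (ulsubmx (Y None)) (drsubmx (Y None)) (\sum_(i < n) drsubmx (Y _)).
by move=> x1 x2 x3 y1 y2 y3; apply/matrixP => k l; rewrite !mxE; ring.
Qed.

(** The form of the objective that is visibly linear and continuous in X. *)
Lemma objectiveE X : objective X = mxdot A0 (ulsubmx (X None))
  - 2 * \sum_i mxdot (A i) (ursubmx (X (Some i))).
Proof.
rewrite /objective /dual_objective /= mulr_sumr -sumrN; congr (_ + _).
apply: eq_bigr => i _; rewrite mxdotDr trmxC_N !mxdotNr.
have -> : mxdot (A i) ((ursubmx (X (Some i))) ^t*) = mxdot (A i) (ursubmx (X (Some i))).
  by rewrite -{1}(herm_trmxC (A_herm i)) mxdot_trmxC.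
by move: (mxdot _ _) => u; ring.
Qed.

Lemma objective_combine s X Y :
  objective (combine s X Y) = (1 - s) * objective X + s * objective Y.
Proof.
rewrite !objectiveE /combine ulsub_comb mxdotDr !mxdotZr.
have -> : \sum_i mxdot (A i) (ursubmx ((1 - s)%:C *: X (Some i) + s%:C *: Y (Some i)))
  = (1 - s) * (\sum_i mxdot (A i) (ursubmx (X (Some i))))
    + s * (\sum_i mxdot (A i) (ursubmx (Y (Some i)))).
  rewrite !mulr_sumr -big_split /=; apply: eq_bigr => i _.
  by rewrite ursub_comb mxdotDr !mxdotZr.
move: (\sum_i _) (\sum_i _) (mxdot _ _) (mxdot _ _) => u v w z; ring.
Qed.

Lemma trace_simplex_combine s X Y : 0 <= s -> s <= 1 ->
  trace_simplex X -> trace_simplex Y -> trace_simplex (combine s X Y).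
Proof.
move=> s0 s1 [pX uX dX tX] [pY uY dY tY]; have s1' : 0 <= 1 - s by rewrite subr_ge0.
rewrite /combine; split.
- by move=> t; exact: (psdD (psdZ s1' (pX t)) (psdZ s0 (pY t))).
- by rewrite ulsub_comb mxtraceD !mxtraceZ ReD !ReZ uX uY !mulr1 subrK.
- by rewrite drsub_comb mxtraceD !mxtraceZ ReD !ReZ; nra.
by move=> i; rewrite mxtraceD !mxtraceZ ReD !ReZ tX tY !mulr1 subrK.
Qed.

Lemma residual_continuous j : fam_mx_continuous (fun X => residual X j).
Proof.
have cproj t : fam_mx_continuous (fun X : family => X t) := fam_mx_continuous_proj t.
have cul t := fam_mx_continuous_ulsub (cproj t).
have cdr t := fam_mx_continuous_drsub (cproj t).
case: j => [i|] /=; first exact: (fam_mx_continuousB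
  (fam_mx_continuousD (cul (Some i)) (cdr (Some i))) (cul None)).
exact: (fam_mx_continuousB (cdr None) (fam_mx_continuousB (cul None)
  (fam_mx_continuous_sum _ (fun i => cdr (Some i))))).
Qed.

Lemma objective_continuous : fam_continuous objective.
Proof.
have cproj t : fam_mx_continuous (fun X : family => X t) := fam_mx_continuous_proj t.
have c1 := fam_mx_continuousE (fam_mx_continuous_ulsub (cproj None)) A0.
have c2 := fam_continuous_sum (index_enum 'I_n) (fun i => fam_mx_continuousE
  (fam_mx_continuous_ursub (cproj (Some i))) (A i)).
apply: (fam_continuous_ext (fam_continuousB c1
  (fam_continuousM (@fam_continuous_cst _ _ _ 2) c2))) => X.
by rewrite objectiveE.
Qed.

Lemma trace_simplex_closed : fam_closed trace_simplex.
Proof.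
have cproj t : fam_mx_continuous (fun X : family => X t) := fam_mx_continuous_proj t.
have cst c := @fam_continuous_cst R (d + d) (option 'I_n) c.
have ctr t := fam_continuous_Re_tr (cproj t).
have cul := fam_continuous_Re_tr (fam_mx_continuous_ulsub (cproj None)).
have cdr := fam_continuous_Re_tr (fam_mx_continuous_drsub (cproj None)).
have := fam_closedI (fam_closed_forall (fun t => fam_closed_psd (cproj t)))
  (fam_closedI (fam_closed_eq cul (cst 1))
  (fam_closedI (fam_closed_le cdr (cst 1))
     (fam_closed_forall (fun i => fam_closed_eq (ctr (Some i)) (cst 1))))).
congr fam_closed; apply/seteqP; split=> X /=.
  by move=> [? [? [? ?]]].
by move=> [].
Qed.

Lemma trace_simplex_bounded X t : trace_simplex X ->
  psdmx (X t) /\ complex.Re (\tr (X t)) <= 2.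
Proof.
move=> [pX uX dX tX]; split; first exact: pX.
case: t => [i|]; first by rewrite tX ler1n.
by rewrite mxtrace_blocks ReD uX; move: dX; lra.
Qed.

Lemma dual_of_family_feasible X : trace_simplex X ->
  (forall j, residual X j = 0) -> dual_feasible (dual_of_family X).
Proof.
move=> [pX uX dX tX] rX.
have hX t := psd_herm (pX t).
have res0 := rX None; move/eqP: res0; rewrite subr_eq0 => /eqP res0.
split.
- by split=> [|i]; [exact: herm_ulsub | split; [exact: herm_ulsub | exact: herm_drsub]].
- move=> i; rewrite dual_of_blocksK //; split; first exact: pX.
  by apply/eqP; rewrite -subr_eq0; apply/eqP; exact: (rX (Some i)).
- by rewrite -res0; exact: (psd_drsub (pX None)).
by rewrite herm_tr /= ?uX //; exact: herm_ulsub.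
Qed.

Definition family_of_dual (y : dual_var R d n) : family := fun t =>
  if t is Some i then dual_block y i else block_mx (dDelta y) 0 0 (dual_slack y).

Lemma dual_slack_family y : dual_slack (dual_of_family (family_of_dual y)) = dual_slack y.
Proof.
rewrite /dual_slack /= block_mxKul; congr (_ - _).
by apply: eq_bigr => i _; rewrite block_mxKdr.
Qed.

Lemma family_of_dual_simplex y : dual_feasible y ->
  trace_simplex (family_of_dual y).
Proof.
move=> fy; have [_ pD _] := dual_feasible_domain n_gt0 fy.
have [hy hb ps tr1] := fy.
have pT i : psdmx (dT y i).
  by have [pb _] := hb i; have := psd_drsub pb; rewrite block_mxKdr.
split=> [[i|]|||i] /=.
- by have [] := hb i.
- exact: (psd_block_diag pD ps).
- by rewrite block_mxKul tr1.
- rewrite block_mxKdr /dual_slack mxtraceD raddfN /= ReD ReN tr1 Re_tr_sum /=.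
  rewrite gerDl oppr_le0 sumr_ge0 // => i _; exact: (psd_tr_ge0 (pT i)).
by rewrite mxtrace_block -mxtraceD; have [_ ->] := hb i; rewrite tr1.
Qed.

Lemma family_of_dual_residual y j : dual_feasible y ->
  residual (family_of_dual y) j = 0.
Proof.
move=> [_ hb _ _]; case: j => [i|] /=.
  rewrite !block_mxKul block_mxKdr; have [_ ->] := hb i; exact: subrr.
by rewrite dual_slack_family block_mxKdr subrr.
Qed.

Lemma family_of_dual_objective y :
  objective (family_of_dual y) = dual_objective A0 A y.
Proof.
rewrite /objective /dual_objective /= block_mxKul; congr (_ + _).
by apply: eq_bigr => i _; rewrite block_mxKur opprK.
Qed.

Lemma dual_feasible_ex : exists y : dual_var R d n, dual_feasible y.
Proof.
pose D : 'M[C]_d := (d%:R^-1)%:C%:M.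
have pD : psdmx D by apply: psd_scalar; rewrite invr_ge0.
exists (DualVar D (fun=> D) (fun=> 0) (fun=> 0)); split.
- split=> [|i]; first exact: psd_herm pD.
  by split; [exact: psd_herm pD | exact: herm0].
- move=> i; split; last by rewrite addr0.
  by rewrite /dual_block /= trmxC_0 oppr0; exact: (psd_block_diag pD (psd0 _)).
- have -> : dual_slack (DualVar D (fun _ : 'I_n => D) (fun=> 0) (fun=> 0)) = D.
    by rewrite /dual_slack /= (big1 _ _) ?subr0.
  exact: pD.
rewrite /= herm_tr; last exact: psd_herm pD.
rewrite -mxdot1 mxdotC mxdot_scalar mxtrace1.
have -> : complex.Re (d%:R : C) = d%:R.
  by elim: d => // k IH; rewrite mulrSr ReD IH mulrSr.
by rewrite mulVf // pnatr_eq0 -lt0n.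
Qed.

Lemma dual_attained : exists2 y, dual_feasible y &
  forall z, dual_feasible z -> dual_objective A0 A z <= dual_objective A0 A y.
Proof.
have [y0 fy0] := dual_feasible_ex.
have cF := fam_closedI trace_simplex_closed (fam_closed_forall (fun j =>
  fam_closed_mx_eq (residual_continuous j) (fam_mx_continuous_cst 0))).
have [||X [sX rX] Xmin] := @psd_family_min _ _ _ _ 2 _ _ cF _ (fam_continuousN objective_continuous).
- exists (family_of_dual y0); split; first exact: family_of_dual_simplex.
  by move=> j; exact: family_of_dual_residual.
- by move=> X t [/trace_simplex_bounded b _]; exact: b.
exists (dual_of_family X); first exact: dual_of_family_feasible.
move=> z fz; rewrite -family_of_dual_objective -lerN2; apply: Xmin.
split; first exact: family_of_dual_simplex.
by move=> j; exact: family_of_dual_residual.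
Qed.

(** The point of the compact convex set of all (residuals, t - objective) of
    least norm is not 0 if t exceeds the dual value; it is a functional that
    separates 0 from this set, and its coordinates are the multipliers. *)
Lemma multipliers (t : R) :
  (forall y, dual_feasible y -> dual_objective A0 A y < t) ->
  exists M : option 'I_n -> 'M[C]_d, (forall j, M j \is hermsymmx) /\
    forall X, trace_simplex X ->
      objective X < t + \sum_j mxdot (M j) (residual X j).
Proof.
move=> tmax.
pose phi X := \sum_j mxdot (residual X j) (residual X j) + (t - objective X) ^+ 2.
have cphi : fam_continuous phi.
  apply: fam_continuousD.
    by apply: fam_continuous_sum => j; exact: fam_continuous_sqr (residual_continuous j).
  have ct := fam_continuousB (@fam_continuous_cst _ _ _ t) objective_continuous.
  exact: (fam_continuousM ct ct).
have [y0 fy0] := dual_feasible_ex.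
have sX1 := family_of_dual_simplex fy0.
have [|X t' sX|X0 sX0 X0min] := @psd_family_min _ _ _ _ 2 _ _ trace_simplex_closed _ cphi.
- by exists (family_of_dual y0).
- exact: trace_simplex_bounded.
pose a := residual X0; pose e := t - objective X0.
have vi X : trace_simplex X ->
    phi X0 <= \sum_j mxdot (a j) (residual X j) + e * (t - objective X).
  move=> sX; apply: least_norm_variational => s s0 s1.
  have := X0min _ (trace_simplex_combine s0 s1 sX0 sX).
  rewrite {2}/phi objective_combine.
  under eq_bigr do rewrite residual_combine.
  have -> : t - ((1 - s) * objective X0 + s * objective X) =
    (1 - s) * e + s * (t - objective X) by rewrite /e; ring.
  exact.
have sum0 : 0 <= \sum_j mxdot (a j) (a j).
  by apply: sumr_ge0 => j _; exact: mxdot_ge0.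
(* If phi vanished at X0, this would be a feasible point of value t. *)
have phi0 : 0 < phi X0.
  rewrite lt_neqAle eq_sym addr_ge0 ?sqr_ge0 // andbT.
  apply/eqP => /eqP; rewrite paddr_eq0 ?sqr_ge0 // => /andP[/eqP s0].
  rewrite sqrf_eq0 subr_eq0 => /eqP te.
  have r0 j : residual X0 j = 0.
    apply: mxdot_eq0; apply/eqP; move/eqP: s0.
    by rewrite psumr_eq0 => [/allP/(_ j (mem_index_enum _))|k _]; [|exact: mxdot_ge0].
  have := tmax _ (dual_of_family_feasible sX0 r0).
  by rewrite -/(objective X0) -te ltxx.
(* Any feasible point has zero residuals and value below t, so that the sign
   of e can be read off from the inequality. *)
have e0 : 0 < e.
  have := vi _ sX1; rewrite big1 => [|j _]; last first.
    by rewrite family_of_dual_residual // mxdot0r.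
  rewrite add0r family_of_dual_objective => /(lt_le_trans phi0).
  by rewrite pmulr_lgt0 // subr_gt0; exact: tmax.
exists (fun j => (e^-1)%:C *: a j); split.
  move=> j; apply: hermZ; have [pX _ _ _] := sX0.
  have hX k := psd_herm (pX k); rewrite /a; case: j => [i|] /=.
    exact: (hermB (hermD (herm_ulsub (hX _)) (herm_drsub (hX _))) (herm_ulsub (hX _))).
  exact: (hermB (herm_drsub (hX _)) (hermB (herm_ulsub (hX _))
    (herm_sum (fun i => herm_drsub (hX (Some i)))))).
move=> X sX; have := lt_le_trans phi0 (vi X sX).
under [X in _ -> _ < t + X]eq_bigr do rewrite mxdotZl.
rewrite -mulr_sumr -(pmulr_rgt0 _ (_ : 0 < e^-1)) ?invr_gt0 // mulrDr mulKf ?gt_eqF //.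
by move: (e^-1 * _) => u h; lra.
Qed.

(** The multipliers of the previous lemma need not be feasible, since they bound
    the Lagrangian on trace-normalized matrices only. Tested on bottom
    eigenvectors, this bound says that the least eigenvalues m_i of the blocks,
    m0 of the slack and min (0, least eigenvalue) = v of Z have a positive sum.
    Hence Z - v I and Y_i - m_i I still satisfy the slack constraint with
    c = t. *)
Lemma strong_duality (t : R) :
  (forall y, dual_feasible y -> dual_objective A0 A y < t) ->
  exists2 x, primal_feasible A0 A x & pc x = t.
Proof.
move=> /multipliers[M [hM sep]].
pose Z := M None; pose Y i := M (Some i); pose x := PrimalVar t Z Y.
have hblock i : primal_block A x i \is hermsymmx.
  rewrite /primal_block -{2}(herm_trmxC (A_herm i)).
  exact: (herm_block _ (hM (Some i)) (hermD (hM (Some i)) (hM None))).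
have hslack : primal_slack A0 x \is hermsymmx.
  exact: (hermB (herm_scalar _ _) (hermD (hermD (hM None) A0_herm)
    (herm_sum (fun i => hM (Some i))))).
have dd0 : (0 < d + d)%N by rewrite addn_gt0 d_gt0.
have pos (D P : 'M[C]_d) (G : 'I_n -> 'M[C]_(d + d)) :
    psdmx D -> complex.Re (\tr D) = 1 -> psdmx P -> complex.Re (\tr P) <= 1 ->
    (forall i, psdmx (G i)) -> (forall i, complex.Re (\tr (G i)) = 1) ->
    0 < \sum_i mxdot (G i) (primal_block A x i) + mxdot D (primal_slack A0 x)
        + mxdot Z P.
  move=> pD tD pP tP pG tG.
  pose X k := if k is Some i then G i else block_mx D 0 0 P.
  have sX : trace_simplex X.
    split=> [[i|]|||] /=; [exact: pG | exact: (psd_block_diag pD pP) | | | exact: tG].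
      by rewrite block_mxKul.
    by rewrite block_mxKdr.
  have := dual_lagrangianE A0 A (dual_of_family X) x.
  rewrite /dual_lagrangian -/(objective X) /= block_mxKul tD subrr mulr0 addr0.
  have := sep X sX; rewrite sum_option /= mxdotBr block_mxKdr block_mxKul.
  have -> : \sum_i mxdot (M (Some i)) (ulsubmx (G i) + drsubmx (G i) - D) =
    - \sum_i mxdot (Y i) (D - (ulsubmx (G i) + drsubmx (G i))).
    by rewrite -sumrN; apply: eq_bigr => i _; rewrite -mxdotNr opprB.
  have -> : \sum_i mxdot (dual_block (dual_of_family X) i) (primal_block A x i) =
    \sum_i mxdot (G i) (primal_block A x i).
    apply: eq_bigr => i _; rewrite dual_of_blocksK //; exact: psd_herm (pG i).
  rewrite -/Z; move: (\sum_i _) (\sum_i _) (mxdot _ _) (mxdot _ _) (mxdot _ _).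
  by move: (objective X) => u1 u2 u3 u4 u5 u6 h1 h2; lra.
have /choice[m /choice[G hG]] := fun i => herm_bottom dd0 (hblock i).
have [m0 [D [pD tD mD pm0]]] := herm_bottom d_gt0 hslack.
have [v [P [pP tP mP v0 pv]]] : exists v : R, exists P : 'M[C]_d,
    [/\ psdmx P, complex.Re (\tr P) <= 1, mxdot Z P = v, v <= 0
      & psdmx (Z - v%:C%:M)].
  have [z [P [pP tP mP pz]]] := herm_bottom d_gt0 (hM None).
  have [z0|z0] := leP 0 z.
    exists 0, 0; split; [exact: psd0 | | exact: mxdot0r | exact: lexx |].
      by rewrite mxtrace0 ler01.
    rewrite raddf0 subr0 -[Z](subrK (z%:C%:M)).
    exact: (psdD pz (psd_scalar _ z0)).
  exists z, P; split; [exact: pP | by rewrite tP | | exact: ltW | exact: pz].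
  by rewrite mxdotC.
have sum_pos : 0 < \sum_i m i + m0 + v.
  have := pos D P G pD tD pP tP (fun i => let: And4 p _ _ _ := hG i in p)
    (fun i => let: And4 _ p _ _ := hG i in p).
  rewrite mD mP (eq_bigr m) // => i _.
  by have [_ _ ->] := hG i.
exists (PrimalVar t (Z - v%:C%:M) (fun i => Y i - (m i)%:C%:M)); last by [].
apply: primal_feasibleI; first exact: pv.
  move=> i; rewrite /primal_block /= shift_block -scalar_mx_block.
  have -> : - v%:C%:M = (- v)%:C%:M :> 'M[C]_d by rewrite rmorphN raddfN.
  have [_ _ _ pG] := hG i.
  have nv : 0 <= - v by rewrite oppr_ge0.
  exact: (psdD pG (psd_block_diag (psd0 _) (psd_scalar _ nv))).
rewrite /primal_slack /= sumrB (shift_slack _ _ _ _ _ _ m0%:C%:M).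
have -> : v%:C%:M + m0%:C%:M + \sum_i (m i)%:C%:M =
    (v + m0 + \sum_i m i)%:C%:M :> 'M[C]_d.
  by rewrite !rmorphD /= !rmorph_sum.
by apply: (psdD pm0); apply: psd_scalar; lra.
Qed.

End StrongDuality.

(** * The theorem *)

Theorem theorem1p15 (R : realType) (d n : nat)
    (d_gt0 : (0 < d)%N) (n_gt0 : (0 < n)%N)
    (A0 : 'M[R[i]]_d) (A : 'I_n -> 'M[R[i]]_d)
    (A0_herm : A0 \is hermsymmx) (A_herm : forall i, A i \is hermsymmx) :
  [/\ primal_value A0 A = Lambda_rad A0 A /\
      dual_value A0 A = Lambda_rad A0 A,
      dual_is_lagrangian_dual_of_primal A0 A /\
      primal_is_lagrangian_dual_of_dual A0 A,
      (exists x : primal_var R d n,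
        primal_feasible A0 A x /\ (pc x)%:E = primal_value A0 A) &
      (exists y : dual_var R d n,
        dual_feasible y /\ (dual_objective A0 A y)%:E = dual_value A0 A)].
Proof.
have [x0 fx0] := primal_feasible_ex d_gt0 A0_herm A_herm.
have [x fx xmin] := primal_attained d_gt0 fx0.
have [y fy ymax] := dual_attained A0 d_gt0 n_gt0 A_herm.
have xy : pc x = dual_objective A0 A y.
  apply/eqP; rewrite eq_le (weak_duality n_gt0 fx fy) andbT.
  apply/ler_addgt0Pr => e e0.
  have [|x' fx' <-] := strong_duality d_gt0 n_gt0 A0_herm A_herm
    (t := dual_objective A0 A y + e); last exact: xmin.
  by move=> z fz; apply: le_lt_trans (ymax z fz) _; rewrite ltrDl.
have primalE : primal_value A0 A = (pc x)%:E by exact: ereal_inf_image_min.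
have dualE : dual_value A0 A = (dual_objective A0 A y)%:E.
  exact: ereal_sup_image_max.
have LambdaE := primal_value_Lambda d_gt0 A0_herm A_herm.
split.
- by split; rewrite // -LambdaE primalE dualE xy.
- split; first exact: dual_is_lagrangian_dual.
  exact: primal_is_lagrangian_dual.
- by exists x.
by exists y.
Qed.
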